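(* Let $F=f+\phi$ satisfy the assumptions in the context, and run the ACPP algorithm (described in the context) with starting point $x^0$, $K\ge1$, and $t$ inner iterations. Let $\kappa=\tilde L_{\max}/\tilde L_{\min}$, $\eta=\frac{\sqrt{\tilde\mu_1}}{m}$, and assume that $\lambda=(1-\eta)^t<\frac12$. Then there exists a random point $x^{\hat k^*}$ such that the output $x^{\hat k}$ satisfies $$\mathbb{E}\|x^{\hat{k}}-x^{\hat{k}^{*}}\|^{2}\le\frac{4\kappa\lambda}{K\mu(1-2\lambda)}\Bigl\{\mu\|x^{0}-x^{*}\|^{2}+2\lambda[F(x^{0})-F(x^{*})]\Bigr\},$$ $$\mathbb{E}\bigl[\operatorname{dist}(0,\partial F(x^{\hat{k}^{*}}))\bigr]^{2}\le\frac{8\kappa\mu}{K(1-2\lambda)}\Bigl\{\mu\|x^{0}-x^{*}\|^{2}+2\lambda[F(x^{0})-F(x^{*})]\Bigr\}.$$ In particular, if $t=\bigl\lceil-\eta^{-1}\ln\tilde\lambda\bigr\rceil$ where $\tilde\lambda=\min\bigl\{\frac14,\frac{\mu^2}{L^2},\frac{\mu}{2L}\bigr\}$, then $$\mathbb{E}\|x^{\hat{k}}-x^{\hat{k}^{*}}\|^{2}\le\frac{8\kappa\mu}{KL^{2}}\Bigl\{\mu\|x^{0}-x^{*}\|^{2}+\tfrac{\mu}{L}[F(x^{0})-F(x^{*})]\Bigr\},$$ $$\mathbb{E}\bigl[\operatorname{dist}(0,\partial F(x^{\hat{k}^{*}}))\bigr]^{2}\le\frac{16\kappa\mu}{K}\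Bigl\{\mu\|x^{0}-x^{*}\|^{2}+\tfrac{\mu}{L}[F(x^{0})-F(x^{*})]\Bigr\}.$$
   Context: Notation. $[m]=\{1,\dots,m\}$. $d=\sum_{i=1}^m d_i$, and $U_i\in\mathbb{R}^{d\times d_i}$ are such that $[U_1,\dots,U_m]=I_d$. For $x\in\mathbb{R}^d$, $x_i=U_i^Tx\in\mathbb{R}^{d_i}$ is the $i$-th block; $\nabla_i f(x)=U_i^T\nabla f(x)$. $\|\cdot\|_i$ is the Euclidean norm on $\mathbb{R}^{d_i}$, $\|\cdot\|$ the Euclidean norm on $\mathbb{R}^d$; $\operatorname{dist}(y,X)=\inf_{x\in X}\|x-y\|$. Assumptions. The problem is $\min_{x\in\mathbb{R}^d}F(x)=f(x)+\phi(x)$, where: (i) $f:\mathbb{R}^d\to\mathbb{R}$ is continuously differentiable and block-wise Lipschitz smooth with constants $L_1,\dots,L_m>0$: $\|\nabla_i f(x)-\nabla_i f(x+U_it)\|_i\le L_i\|t\|_i$ for all $x\in\mathbb{R}^d$, $t\in\mathbb{R}^{d_i}$, $i\in[m]$; and $\|\nabla f(x)-\nabla f(y)\|\le L\|x-y\|$ for all $x,y$, with $L>0$; (ii) $f$ is $\mu$-weakly convex, $\mu>0$: $f(x)\ge f(y)+\langle\nabla f(y),x-y\rangle-\frac{\mu}{2}\|x-y\|^2$ for all $x,y$ (the setting of interest is the ill-conditioned one, $\mu\ll L_i$ for all $i\in[m]$); (iii) $\phi(x)=\sum_{i=1}^m\phi_i(x_i)$ with each $\phi_i:\mathbb{R}^{d_i}\to\mathbb{R}$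 proper, convex, lower semicontinuous; (iv) every lower level set $\{x:F(x)\le r\}$, $r\in\mathbb{R}$, is bounded; (v) there is $x^*$ with $F(x^* )=\min_xF(x)>-\infty$. $\partial F$ denotes the limiting subdifferential (here $\partial F(x)=\nabla f(x)+\partial\phi(x)$). Constants: $\tilde L_i=L_i+2\mu$, $\tilde L_{\max}=\max_i\tilde L_i$, $\tilde L_{\min}=\min_i\tilde L_i$, $\tilde\mu_1=\mu/\tilde L_{\max}$. ACPP algorithm. Input $x^0$, $\mu$, $t$. For $k=0,1,\dots,K$: let $F_k(x)=F(x)+\mu\|x-x^k\|^2=f_k(x)+\phi(x)$ with $f_k(x)=f(x)+\mu\|x-x^k\|^2$; let $x^{k+1}$ be the output of $t$ iterations of APCG applied to $F_k$, started at $x^k$, with block constants $\tilde L_i$ and strong convexity parameter $\tilde\mu_1$, using samples independent of the past. Finally choose $\hat k$ uniformly at random from $\{2,3,\dots,K+1\}$, independently of everything else, and output $x^{\hat k}$. The expectation is over all randomness (samples and $\hat k$). APCG (applied to $\hat f+\phi$ with block smoothness constants $\tilde L_i$, parameter $\tilde\mu\in(0,1)$, starting point $w^0$, $t$ iterations). Let $\|x\|_{\widetilde{[1]}}=\sqrt{\sum_i\tilde L_i\|x_i\|_i^2}$. Set $z^0=w^0$ and choose any $\gamma_0\in[\tilde\mu,1]$. For $j=0,\dots,t-1$: compute $\alpha_j\in(0,\frac1m]$ from $m^2\alpha_j^2=(1-\alpha_j)\gamma_j+\alpha_j\tilde\mu$, set $\gamma_{j+1}=(1-\alpha_j)\gamma_j+\alpha_j\tilde\mu$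 and $\beta_j=\alpha_j\tilde\mu/\gamma_{j+1}$; set $y^j=\frac{1}{\alpha_j\gamma_j+\gamma_{j+1}}(\alpha_j\gamma_jz^j+\gamma_{j+1}w^j)$; sample $i_j$ uniformly from $[m]$ (independently) and set $$z^{j+1}=\operatorname{argmin}_x\Bigl\{\tfrac{m\alpha_j}{2}\|x-(1-\beta_j)z^j-\beta_jy^j\|_{\widetilde{[1]}}^2+\langle\nabla_{i_j}\hat f(y^j),x_{i_j}\rangle+\phi_{i_j}(x_{i_j})\Bigr\};$$ set $w^{j+1}=y^j+m\alpha_j(z^{j+1}-z^j)+\frac{\tilde\mu}{m}(z^j-y^j)$. The output is $w^t$. *)

(* Defs.v *)
(* MathComp / MathComp-Analysis. *)
From HB Require Import structures.
From mathcomp Require Export all_boot all_order all_algebra.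
From mathcomp Require Export all_classical all_reals all_analysis.
From mathcomp Require Export measurable_realfun.

Set Implicit Arguments.
Unset Strict Implicit.
Unset Printing Implicit Defensive.

Import Order.TTheory GRing.Theory Num.Theory.
Import numFieldNormedType.Exports.

Local Open Scope classical_set_scope.
Local Open Scope ring_scope.

(* The norm that the library puts on matrices is the sup norm. It is used
   below only through notions on which all norms of a finite-dimensional space
   agree (limits, continuity, differentiability, boundedness); every metric
   quantity uses the Euclidean norm [enorm]. *)
Section euclidean.
Context {R : realType} {n : nat}.
Implicit Types (u v x : 'cV[R]_n) (A : set 'cV[R]_n).

Definition dotv u v : R := (u^T *m v) 0 0.

Definition enorm u : R := Num.sqrt (dotv u u).

(* Infimum in [\bar R]: the distance to the empty set is [+oo]. *)
Definition dist x A : \bar R := ereal_inf [set (enorm (a - x))%:E | a in A].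

Definition grad (f : 'cV[R]_n -> R) x : 'cV[R]_n :=
  \col_j 'D_(delta_mx j 0 : 'cV[R]_n) f x.

Definition C1 (f : 'cV[R]_n -> R) : Prop :=
  (forall x, differentiable f x) /\ continuous (grad f).

Definition weakly_convex (mu : R) (f : 'cV[R]_n -> R) : Prop :=
  forall x y,
    f x >= f y + dotv (grad f y) (x - y) - mu / 2 * enorm (x - y) ^+ 2.

End euclidean.

Section extended_functions.
Context {R : realType} {n : nat}.
Implicit Types (g : 'cV[R]_n -> \bar R) (x v : 'cV[R]_n).
Local Open Scope ereal_scope.

Definition eproper g : Prop :=
  (forall x, -oo < g x) /\ exists x, g x < +oo.

Definition econvex g : Prop :=
  forall x y (s : R), (0 < s < 1)%R ->
    g (s *: x + (1 - s) *: y)%R <= s%:E * g x + (1 - s)%R%:E * g y.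

Definition is_argmin g x : Prop := forall u, g x <= g u.

(* [liminf (g y - g x - <v, y - x>) / |y - x| >= 0] as [y -> x], [y <> x]. *)
Definition regular_subdifferential g x : set 'cV[R]_n :=
  [set v | g x \is a fin_num /\
    forall e : R, (0 < e)%R ->
      \forall y \near x,
        g x + (dotv v (y - x) - e * enorm (y - x))%:E <= g y].

Definition limiting_subdifferential g x : set 'cV[R]_n :=
  [set v | g x \is a fin_num /\
    exists (xs vs : nat -> 'cV[R]_n),
      [/\ xs @ \oo --> x, g \o xs @ \oo --> g x, vs @ \oo --> v &
          forall k, regular_subdifferential g (xs k) (vs k)]].

End extended_functions.

Section blocks.
Context {R : realType} {m : nat} {d : 'I_m -> nat}.
Local Notation D := (\sum_(i < m) d i)%N.

Definition U (i : 'I_m) : 'M[R]_(D, d i) := submxrow 1%:M i.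

Lemma mxrow_U : \mxrow_i U i = 1%:M.
Proof. exact: submxrowK. Qed.

Definition block (i : 'I_m) (x : 'cV[R]_D) : 'cV[R]_(d i) := (U i)^T *m x.

Definition block_smooth (L : 'I_m -> R) (f : 'cV[R]_D -> R) : Prop :=
  forall (x : 'cV[R]_D) (i : 'I_m) (h : 'cV[R]_(d i)),
    enorm (block i (grad f x) - block i (grad f (x + U i *m h)))
      <= L i * enorm h.

Definition separable (phi : forall i, 'cV[R]_(d i) -> \bar R) (x : 'cV[R]_D)
  : \bar R := (\sum_(i < m) phi i (block i x))%E.

Definition objective (f : 'cV[R]_D -> R)
    (phi : forall i, 'cV[R]_(d i) -> \bar R) (x : 'cV[R]_D) : \bar R :=
  ((f x)%:E + separable phi x)%E.

Definition wnorm (Lt : 'I_m -> R) (x : 'cV[R]_D) : R :=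
  Num.sqrt (\sum_(i < m) Lt i * enorm (block i x) ^+ 2).

(* [apcg f phi Lt mut gamma0 t s w0 wt]: on the sampled blocks
   [s 0, ..., s t.-1], APCG for [f + phi] started at [w0] outputs [wt]. *)
Definition apcg (f : 'cV[R]_D -> R) (phi : forall i, 'cV[R]_(d i) -> \bar R)
    (Lt : 'I_m -> R) (mut gamma0 : R) (t : nat) (s : nat -> 'I_m)
    (w0 wt : 'cV[R]_D) : Prop :=
  exists (alpha beta gamma : nat -> R) (w y z : nat -> 'cV[R]_D),
    [/\ gamma 0%N = gamma0, w 0%N = w0, z 0%N = w0, w t = wt &
    forall j, (j < t)%N ->
      [/\ 0 < alpha j <= m%:R^-1 /\
          m%:R ^+ 2 * alpha j ^+ 2 = (1 - alpha j) * gamma j + alpha j * mut,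
          gamma j.+1 = (1 - alpha j) * gamma j + alpha j * mut /\
          beta j = alpha j * mut / gamma j.+1,
          y j = (alpha j * gamma j + gamma j.+1)^-1 *:
                  ((alpha j * gamma j) *: z j + gamma j.+1 *: w j),
          is_argmin (fun x : 'cV[R]_D =>
            (m%:R * alpha j / 2 *
               wnorm Lt (x - (1 - beta j) *: z j - beta j *: y j) ^+ 2 +
             dotv (block (s j) (grad f (y j))) (block (s j) x))%:E
            + phi (s j) (block (s j) x))%E (z j.+1) &
          w j.+1 = y j + (m%:R * alpha j) *: (z j.+1 - z j)
                   + (mut / m%:R) *: (z j - y j)]].

Definition Ltilde (L : 'I_m -> R) (mu : R) (i : 'I_m) : R := L i + 2 * mu.

Definition Ltilde_max (L : 'I_m -> R) (mu : R) : R :=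
  \big[Num.max/0]_(i < m) Ltilde L mu i.

(* Both default values are irrelevant for [0 < m] and [0 <= Ltilde L mu i]. *)
Definition Ltilde_min (L : 'I_m -> R) (mu : R) : R :=
  \big[Num.min/Ltilde_max L mu]_(i < m) Ltilde L mu i.

Definition mutilde1 (L : 'I_m -> R) (mu : R) : R := mu / Ltilde_max L mu.

(* [x 0, ..., x K.+1] are the ACPP iterates when block [s k j] is sampled at
   inner iteration [j] of outer iteration [k]; [gamma0 k] is the parameter
   chosen for the [k]-th call to APCG. *)
Definition acpp (f : 'cV[R]_D -> R) (phi : forall i, 'cV[R]_(d i) -> \bar R)
    (L : 'I_m -> R) (mu : R) (gamma0 : nat -> R) (K t : nat)
    (s : nat -> nat -> 'I_m) (x0 : 'cV[R]_D) (x : nat -> 'cV[R]_D) : Prop :=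
  x 0%N = x0 /\
  forall k, (k <= K)%N ->
    apcg (fun u => f u + mu * enorm (u - x k) ^+ 2) phi
      (Ltilde L mu) (mutilde1 L mu) (gamma0 k) t (s k) (x k) (x k.+1).

End blocks.

Section sampling.
Context {R : realType} {dO : measure_display} {Omega : measurableType dO}.
Variable P : probability Omega R.

(* Mutual independence of a finite family of discrete random variables. *)
Definition mutually_independent (A : finType) (X : A -> Omega -> nat) : Prop :=
  forall (J : {set A}) (a : A -> nat),
    P [set w | forall i, i \in J -> X i w = a i] =
    (\prod_(i in J) fine (P [set w | X i w = a i]))%:E.

(* All the randomness of ACPP: [Some (k, j)] is the block sampled at inner
   iteration [j] of outer iteration [k], [None] is the output index. *)
Definition acpp_rv (m K t : nat) (I : nat -> nat -> Omega -> 'I_m)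
    (khat : Omega -> nat) (a : option ('I_K.+1 * 'I_t)) : Omega -> nat :=
  if a is Some kj then fun w => I kj.1 kj.2 w else khat.

Definition acpp_sampling (m K t : nat) (I : nat -> nat -> Omega -> 'I_m)
    (khat : Omega -> nat) : Prop :=
  [/\ forall a, measurable_fun setT (acpp_rv (K := K) (t := t) I khat a),
      forall k j (i : 'I_m), (k <= K)%N -> (j < t)%N ->
        P [set w | I k j w = i] = (m%:R^-1)%:E,
      forall w, (2 <= khat w <= K.+1)%N,
      forall l, (2 <= l <= K.+1)%N -> P [set w | khat w = l] = (K%:R^-1)%:E &
      mutually_independent (acpp_rv (K := K) (t := t) I khat)].

(* A random point: a vector whose coordinates are random variables. *)
Definition random_point (n : nat) (X : Omega -> 'cV[R]_n) : Prop :=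
  forall j, measurable_fun setT (fun w => X w j 0).

End sampling.

(* Main.v *)
Require Import Defs.
From mathcomp Require Import ring lra.

(** Write [F x] for [f x + phi x] and [Fp x u = F u + mu |u - x|^2] for the
    subproblem centred at [x]. A round of ACPP starts at [x], runs [t] steps of
    APCG on [Fp x] from [x] itself, and returns [w].

    APCG. Weak convexity and the block constants make the smooth part of
    [Fp x] convex with modulus [mut] and block smooth in the norm weighted by
    the [Ltilde i]. One step contracts, on average over the sampled block,
    the Lyapunov function [Fp x w + g / 2 |z - u|^2] towards [Fp x u] by the
    factor [1 - alpha], for every comparison point [u]; in it [phi w] is
    replaced by a majorant that is linear in the values of [phi] at the points
    [z] ([apcg_step_state]). Averaging over all samples ([apcg_run_mean],
    [round_mean]) bounds the mean of [Fp x w] by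
    [La F x + (1 - La) Fp x u + Th mu / 2 |u - x|^2], where [La] is the
    product of the factors [1 - alpha] and [Th = La g / mut]. Both depend on the
    initial parameter [g], but with [lam = (1 - eta)^t] the inequality
    [(1 - lam)^2 (1 - La + Th) <= (1 + lam)^2 (1 - La)^2] holds for every [g]
    between [mut] and [1] ([apcg_rate_tradeoff]). It controls the best choice
    of [u] on the segment from [x] to a target point: with the minimizer of
    [Fp x] as target, the mean optimality gap [eps] of [w] is at most
    [4 lam / (1 + lam)^2] times the gap [Dl] of [x].

    A stationary point near [w]. Let [p] minimize
    [Fp x + mu / 4 |. - w|^2] ([output_point]). Strong convexity gives
    [mu |w - p|^2 <= Fp x w - min (Fp x)], and by optimality
    [- 2 mu ((p - x) + (p - w) / 4)] is a subgradient of [F] at [p]. The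
    decrease of [F] over the round is [Dl - eps + mu |w - x|^2] on average; by
    the contraction it dominates both the mean of [|w - p|^2] and the mean
    squared length of the subgradient ([round_progress]).

    Telescoping. The mean decreases of [F] over the [K] rounds after the first
    add up to at most the mean of [F x_1 - F xs], where [xs] is the global
    minimizer ([process_cost_tail]). The same APCG estimate, with [u] on the segment from
    [x_0] to [xs], bounds it by
    [mu |x_0 - xs|^2 + 2 lam (F x_0 - F xs)] ([first_round]). As [khat] is
    uniform and independent of the samples, the expectation at the round that
    produces the output is the average over these [K] rounds.

    Randomness. Each round determines its result from the samples
    ([apcg_run_unique]), so all quantities are functions of the finitely many
    values of samples and [khat]. Independence makes these values equally
    likely ([outcome_uniform]), and expectations become finite averages, which
    are treated one round at a time. If [F x_0] is infinite, so are the
    bounds. *)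

Set Implicit Arguments.
Unset Strict Implicit.
Unset Printing Implicit Defensive.
Import Order.TTheory GRing.Theory Num.Theory.
Import numFieldNormedType.Exports.

Local Open Scope classical_set_scope.
Local Open Scope ring_scope.

(** * Euclidean geometry *)

Section euclid.
Context {R : realType} {n : nat}.
Implicit Types (u v w : 'cV[R]_n) (a b : R).

Lemma dotvE u v : dotv u v = \sum_i u i 0 * v i 0.
Proof. by rewrite /dotv mxE; apply: eq_bigr => i _; rewrite mxE. Qed.

Lemma dotvC u v : dotv u v = dotv v u.
Proof. by rewrite !dotvE; apply: eq_bigr => i _; rewrite mulrC. Qed.

Lemma dotvDl u v w : dotv (u + v) w = dotv u w + dotv v w.
Proof. by rewrite /dotv linearD mulmxDl mxE. Qed.

Lemma dotvDr u v w : dotv w (u + v) = dotv w u + dotv w v.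
Proof. by rewrite dotvC dotvDl !(dotvC _ w). Qed.

Lemma dotvZl a u v : dotv (a *: u) v = a * dotv u v.
Proof. by rewrite /dotv linearZ -scalemxAl mxE. Qed.

Lemma dotvZr a u v : dotv u (a *: v) = a * dotv u v.
Proof. by rewrite dotvC dotvZl dotvC. Qed.

Lemma dotvNl u v : dotv (- u) v = - dotv u v.
Proof. by rewrite -scaleN1r dotvZl mulN1r. Qed.

Lemma dotvNr u v : dotv u (- v) = - dotv u v.
Proof. by rewrite dotvC dotvNl dotvC. Qed.

Lemma dotvBl u v w : dotv (u - v) w = dotv u w - dotv v w.
Proof. by rewrite dotvDl dotvNl. Qed.

Lemma dotvBr u v w : dotv w (u - v) = dotv w u - dotv w v.
Proof. by rewrite dotvDr dotvNr. Qed.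

Lemma dotv0r u : dotv u 0 = 0.
Proof. by rewrite -(scale0r 0) dotvZr mul0r. Qed.

Lemma dotvv_ge0 u : 0 <= dotv u u.
Proof. by rewrite dotvE sumr_ge0// => i _; rewrite -expr2 sqr_ge0. Qed.

Lemma enorm_sqr u : enorm u ^+ 2 = dotv u u.
Proof. by rewrite sqr_sqrtr// dotvv_ge0. Qed.

Lemma enorm_ge0 u : 0 <= enorm u.
Proof. exact: sqrtr_ge0. Qed.

Lemma enorm0 : enorm (0 : 'cV[R]_n) = 0.
Proof. by rewrite /enorm dotv0r sqrtr0. Qed.

Lemma dotvv_eq0 u : dotv u u = 0 -> u = 0.
Proof.
move/eqP; rewrite dotvE psumr_eq0 => [/allP u0|i _]; last first.
  by rewrite -expr2 sqr_ge0.
apply/matrixP => i j; rewrite ord1 mxE; apply/eqP.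
by have := u0 i (mem_index_enum i); rewrite -expr2 sqrf_eq0.
Qed.

Lemma enormZ a u : enorm (a *: u) = `|a| * enorm u.
Proof.
rewrite /enorm dotvZl dotvZr mulrA -expr2 sqrtrM ?sqr_ge0//.
by rewrite sqrtr_sqr.
Qed.

Lemma enormN u : enorm (- u) = enorm u.
Proof. by rewrite -scaleN1r enormZ normrN1 mul1r. Qed.

Lemma Cauchy_Schwarz u v : dotv u v <= enorm u * enorm v.
Proof.
have [->|v0] := eqVneq v 0; first by rewrite dotv0r mulr_ge0// enorm_ge0.
have vv : 0 < dotv v v.
  rewrite lt_neqAle dotvv_ge0 andbT eq_sym.
  by apply: contra v0 => /eqP/dotvv_eq0 ->.
have H : dotv u v ^+ 2 <= dotv u u * dotv v v.
  have := dotvv_ge0 (dotv v v *: u - dotv u v *: v).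
  rewrite dotvBl !dotvBr !dotvZl !dotvZr (dotvC v u).
  set p := dotv v v in vv *; set q := dotv u v; set r := dotv u u.
  have -> : p * (p * r) - p * (q * q) - (q * (p * q) - q * (q * p))
            = p * (r * p - q ^+ 2) by ring.
  by rewrite pmulr_rge0// subr_ge0.
rewrite (le_trans (ler_norm _))// -sqrtr_sqr /enorm -sqrtrM ?dotvv_ge0//.
exact: ler_wsqrtr.
Qed.

(** The strong-convexity identity of the squared norm on a segment. *)
Lemma enorm_sqr_conv a u v :
  enorm (a *: u + (1 - a) *: v) ^+ 2
  = a * enorm u ^+ 2 + (1 - a) * enorm v ^+ 2
    - a * (1 - a) * enorm (u - v) ^+ 2.
Proof.
rewrite !enorm_sqr !(dotvDl, dotvDr, dotvZl, dotvZr, dotvNl, dotvNr).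
by rewrite (dotvC v u); ring.
Qed.

Lemma enorm_sqrD u v :
  enorm (u + v) ^+ 2 = enorm u ^+ 2 + 2 * dotv u v + enorm v ^+ 2.
Proof. by rewrite !enorm_sqr !(dotvDl, dotvDr) (dotvC v u); ring. Qed.

(** Expand [|c u - v|^2 >= 0]. *)
Lemma Young_dotv (c : R) u v : 0 < c ->
  2 * dotv u v <= c * enorm u ^+ 2 + c^-1 * enorm v ^+ 2.
Proof.
move=> c0; have := dotvv_ge0 (c *: u - v).
rewrite !(dotvBl, dotvBr, dotvZl, dotvZr) (dotvC v u) !enorm_sqr => H.
rewrite -subr_ge0; have cV : c^-1 * c = 1 by rewrite mulVf// gt_eqF.
have -> : c * dotv u u + c^-1 * dotv v v - 2 * dotv u v =
  c^-1 * (c * (c * dotv u u) - c * dotv u v - (c * dotv u v - dotv v v)).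
  rewrite !mulrBr !mulrA cV !mul1r; ring.
apply: mulr_ge0; first by rewrite invr_ge0 ltW.
by apply: le_trans H _; rewrite le_eqVlt; apply/orP; left; apply/eqP; ring.
Qed.

Lemma dist_sqrC u v : enorm (u - v) ^+ 2 = enorm (v - u) ^+ 2.
Proof. by rewrite -enormN opprB. Qed.

Lemma continuous_enorm_sqr v :
  continuous (fun u : 'cV[R]_n => enorm (u - v) ^+ 2).
Proof.
have -> : (fun u : 'cV[R]_n => enorm (u - v) ^+ 2) =
          (fun u => \sum_i (u i 0 - v i 0) ^+ 2).
  apply/funext => u; rewrite enorm_sqr dotvE.
  by apply: eq_bigr => i _; rewrite !mxE expr2.
apply: continuous_big => [|i _]; first exact: add_continuous.
move=> u.
have Hc : {for u, continuous (fun x : 'cV[R]_n => x i 0 - v i 0)}.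
  apply: continuousB; last exact: cst_continuous.
  exact: coord_continuous.
exact: (continuousM Hc Hc).
Qed.

Lemma continuous_enorm : continuous (@enorm R n).
Proof.
move=> u; have -> : @enorm R n = (fun v => Num.sqrt (enorm (v - 0) ^+ 2)).
  by apply/funext => v; rewrite subr0 sqrtr_sqr ger0_norm// enorm_ge0.
apply: (@continuous_comp _ _ _ (fun v : 'cV[R]_n => enorm (v - 0) ^+ 2) Num.sqrt).
  exact: continuous_enorm_sqr.
exact: sqrt_continuous.
Qed.

End euclid.

(** * Gradients *)

Section gradient.
Context {R : realType} {n : nat}.
Implicit Types (u v w x : 'cV[R]_n) (f : 'cV[R]_n -> R).

Lemma dotv_grad f x v : differentiable f x -> dotv (grad f x) v = 'D_v f x.
Proof.
move=> df; rewrite deriveE// dotvE.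
have {2}-> : v = \sum_j v j 0 *: (delta_mx j 0 : 'cV[R]_n).
  apply/matrixP => i j; rewrite ord1 summxE (bigD1 i)//= big1 => [|k ki].
    by rewrite !mxE !eqxx mulr1 addr0.
  by rewrite !mxE eq_sym (negbTE ki) mulr0.
rewrite linear_sum; apply: eq_bigr => j _.
by rewrite linearZ /= mxE deriveE// mulrC.
Qed.

Lemma is_derive_enorm_sqr (a : R) w x v :
  is_derive x v (fun u => a * enorm (u - w) ^+ 2) (2 * a * dotv (x - w) v).
Proof.
have H : (fun h : R => h^-1 *: ((a * enorm (h *: v + x - w) ^+ 2)
      - a * enorm (x - w) ^+ 2)) @ 0^' --> 2 * a * dotv (x - w) v.
  have H0 : (fun h : R => 2 * a * dotv (x - w) v + h * (a * dotv v v)) @ 0^'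
      --> 2 * a * dotv (x - w) v.
    rewrite -[X in _ --> X]addr0; apply: cvgD; first exact: cvg_cst.
    rewrite -[X in _ --> X](mul0r (a * dotv v v)); apply: cvgM; last exact: cvg_cst.
    exact: cvg_within.
  apply: cvg_trans H0; apply: near_eq_cvg; near=> h.
  have h0 : h != 0 by near: h; exact: nbhs_dnbhs_neq.
  rewrite -(addrA (h *: v)) (enorm_sqrD (h *: v)) enormZ dotvZl exprMn real_normK ?num_real//.
  rewrite (dotvC v) (enorm_sqr v).
  apply: (mulfI h0); set X := (X in h^-1 *: X).
  by rewrite -[h^-1 *: X]/(h^-1 * X) mulVKf// /X; ring.
apply: DeriveDef; last by rewrite /derive; apply/cvg_lim.
by rewrite /derivable; apply/cvg_ex; eexists; exact: H.
Unshelve. all: by end_near. Qed.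

Lemma grad_prox f (a : R) w x : differentiable f x ->
  grad (fun u => f u + a * enorm (u - w) ^+ 2) x = grad f x + (2 * a) *: (x - w).
Proof.
move=> df; apply/matrixP => j k; rewrite ord1 !mxE.
have D := is_derive_enorm_sqr a w x (delta_mx j 0).
rewrite (@deriveD _ _ _ f (fun u => a * enorm (u - w) ^+ 2)); last 2 first.
- exact: diff_derivable.
- exact: ex_derive.
rewrite derive_val dotvE; congr (_ + _ * _).
rewrite (bigD1 j)//= big1 => [|k' kj]; first by rewrite !mxE !eqxx mulr1 addr0.
by rewrite !mxE (negbTE kj) mulr0.
Qed.

Lemma is_derive_line f x v (s : R) : (forall u, differentiable f u) ->
  is_derive s 1 (fun r : R => f (x + r *: v)) (dotv (grad f (x + s *: v)) v).
Proof.
move=> df; rewrite dotv_grad//.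
have D := @diff_derivable _ _ _ _ _ v (df (x + s *: v)).
have H : (fun h : R => h^-1 *: (f (x + (h *: 1 + s) *: v) - f (x + s *: v))) @ 0^'
      --> 'D_v f (x + s *: v).
  move: D => /derivable_nbhs.
  have := @derivableP _ _ _ f (x + s *: v) v (@diff_derivable _ _ _ _ _ v (df (x + s *: v))).
  move=> [D _]; rewrite /derive; move: D; rewrite /derivable => D _.
  apply: cvg_trans D; apply: near_eq_cvg; near=> h.
  by rewrite /= [h *: 1]mulr1 scalerDl addrCA addrA.
apply: DeriveDef; last by rewrite /derive; apply/cvg_lim.
by rewrite /derivable; apply/cvg_ex; eexists; exact: H.
Unshelve. all: by end_near. Qed.

(** The mean value theorem for [f (x + s v) - s <grad f x, v> - M / 2 s^2],
    whose derivative the hypothesis makes nonpositive on [0, 1]. *)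
Lemma descent f x v (M : R) : (forall u, differentiable f u) ->
  (forall c : R, 0 < c < 1 -> dotv (grad f (x + c *: v) - grad f x) v <= M * c) ->
  f (x + v) <= f x + dotv (grad f x) v + M / 2.
Proof.
move=> df H.
pose g (s : R) := f (x + s *: v) + (- dotv (grad f x) v * s - M / 2 * s ^+ 2).
have dg (s : R) : is_derive s 1 g (dotv (grad f (x + s *: v)) v +
    (- dotv (grad f x) v * 1 - M / 2 * (2 * s * 1))).
  apply: is_deriveD; first exact: is_derive_line.
  apply: is_deriveB.
  have D2 : is_derive s (1 : R) (fun s : R => s ^+ 2) (2 * s * 1).
    apply: DeriveDef; first exact: exprn_derivable.
    by rewrite exp_derive /GRing.scale/= expr1.
  exact: (@is_deriveZ _ _ _ (fun s : R => s ^+ 2) (M / 2) s 1 _ D2).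
have [|c /[!in_itv]/= c01] := @MVT _ g _ 0 1 ltr01 (fun s _ => dg s).
  apply/continuous_subspaceT => s; apply/differentiable_continuous.
  by apply/derivable1_diffP; apply: ex_derive.
rewrite /g scale1r scale0r addr0 expr1n expr0n/= !mulr1 !mulr0 !subr0 addr0.
have := H _ c01; rewrite dotvBl; lra.
Qed.

End gradient.

(** * Blocks *)

Section blocks_theory.
Context {R : realType} {m : nat} {d : 'I_m -> nat}.
Local Notation D := (\sum_(i < m) d i)%N.
Implicit Types (u v x y : 'cV[R]_D).

Lemma blockE (i : 'I_m) x : block i x = submxcol x i.
Proof. by rewrite /block /U tr_submxrow trmx1 submxcol_mul mul1mx. Qed.

Lemma blockD i x y : block i (x + y) = block i x + block i y.
Proof. exact: mulmxDr. Qed.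

Lemma blockN i x : block i (- x) = - block i x.
Proof. exact: mulmxN. Qed.

Lemma blockB i x y : block i (x - y) = block i x - block i y.
Proof. by rewrite blockD blockN. Qed.

Lemma blockZ i (a : R) x : block i (a *: x) = a *: block i x.
Proof. by rewrite /block -scalemxAr. Qed.

Lemma mul_U_tr : \sum_i (@U R m d i *m (U i)^T) = 1%:M.
Proof.
by rewrite -mul_mxrow_mxcol -tr_mxrow mxrow_U trmx1 mulmx1.
Qed.

Lemma sum_block x : x = \sum_i U i *m block i x.
Proof.
rewrite -[LHS]mul1mx -mul_U_tr mulmx_suml.
by apply: eq_bigr => i _; rewrite mulmxA.
Qed.

Lemma dotv_block u v : dotv u v = \sum_i dotv (block i u) (block i v).
Proof.
rewrite {1}(sum_block v) /dotv mulmx_sumr summxE.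
by apply: eq_bigr => i _; rewrite mulmxA /block trmx_mul trmxK.
Qed.

Lemma dotv_block1 i u v : (forall l, l != i -> block l v = 0) ->
  dotv u v = dotv (block i u) (block i v).
Proof.
move=> v0; rewrite dotv_block (bigD1 i)//= big1 ?addr0// => l li.
by rewrite v0// dotv0r.
Qed.

Lemma block_ext x y : (forall i, block i x = block i y) -> x = y.
Proof.
by move=> xy; rewrite (sum_block x) (sum_block y); apply: eq_bigr => i _; rewrite xy.
Qed.

Lemma block_U i (h : 'cV[R]_(d i)) : block i (U i *m h) = h.
Proof.
rewrite /block mulmxA; suff -> : (@U R m d i)^T *m U i = 1%:M by rewrite mul1mx.
rewrite -/(block i _) /block /U tr_submxrow trmx1 submxcol_mul mul1mx.
by apply/matrixP => j k; rewrite !mxE -val_eqE tagnat.eq_Rank eqxx.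
Qed.

Lemma block_U_neq i l (h : 'cV[R]_(d i)) : l != i -> block l (U i *m h) = 0.
Proof.
move=> li; rewrite /block mulmxA; suff -> : (@U R m d l)^T *m U i = 0 by rewrite mul0mx.
rewrite /U tr_submxrow trmx1 submxcol_mul mul1mx.
by apply/matrixP => j k; rewrite !mxE -val_eqE tagnat.eq_Rank (negbTE li).
Qed.

Lemma enorm_sqr_block x : enorm x ^+ 2 = \sum_i enorm (block i x) ^+ 2.
Proof. by rewrite enorm_sqr dotv_block; apply: eq_bigr => i _; rewrite enorm_sqr. Qed.

Lemma wnorm_sqr (Lt : 'I_m -> R) x : (forall i, 0 <= Lt i) ->
  wnorm Lt x ^+ 2 = \sum_i Lt i * enorm (block i x) ^+ 2.
Proof.
by move=> L0; rewrite sqr_sqrtr// sumr_ge0// => i _; rewrite mulr_ge0// sqr_ge0.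
Qed.

Lemma wnorm_sqrD1 (Lt : 'I_m -> R) i x : (forall i, 0 <= Lt i) ->
  wnorm Lt x ^+ 2 = Lt i * enorm (block i x) ^+ 2
                    + \sum_(l | l != i) Lt l * enorm (block l x) ^+ 2.
Proof. by move=> L0; rewrite wnorm_sqr// [LHS](bigD1 i). Qed.

Lemma wnorm_sqr1 (Lt : 'I_m -> R) i x : (forall i, 0 <= Lt i) ->
  (forall l, l != i -> block l x = 0) ->
  wnorm Lt x ^+ 2 = Lt i * enorm (block i x) ^+ 2.
Proof.
move=> L0 x0; rewrite (wnorm_sqrD1 i)// [X in _ + X]big1 ?addr0// => l li.
by rewrite x0// enorm0 expr0n mulr0.
Qed.

Lemma wnorm_sqr_conv (Lt : 'I_m -> R) (a : R) u v : (forall i, 0 <= Lt i) ->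
  0 <= a <= 1 ->
  wnorm Lt (a *: u + (1 - a) *: v) ^+ 2
    <= a * wnorm Lt u ^+ 2 + (1 - a) * wnorm Lt v ^+ 2.
Proof.
move=> L0 /andP[a0 a1]; rewrite !wnorm_sqr// !mulr_sumr -big_split/=.
apply: ler_sum => i _; rewrite blockD !blockZ enorm_sqr_conv.
have := sqr_ge0 (enorm (block i u - block i v)); have := L0 i.
move: (enorm _ ^+ 2) (enorm _ ^+ 2) (enorm _ ^+ 2) => A B C Li0 C0.
rewrite -subr_ge0 -[leRHS]/(_); set X := (X in 0 <= X).
have -> : X = Lt i * (a * (1 - a) * A) by rewrite /X; ring.
by rewrite !mulr_ge0// subr_ge0.
Qed.

(** A displacement supported on block [i] sees only the block constant. *)
Lemma block_descent (L : 'I_m -> R) (f : 'cV[R]_D -> R) x v i :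
  (forall u, differentiable f u) -> block_smooth L f ->
  (forall l, l != i -> block l v = 0) ->
  f (x + v) <= f x + dotv (block i (grad f x)) (block i v)
               + L i / 2 * enorm (block i v) ^+ 2.
Proof.
move=> df Lf v0.
have dv u : dotv u v = dotv (block i u) (block i v) by exact: dotv_block1.
have vE : v = U i *m block i v.
  rewrite [LHS]sum_block [LHS](bigD1 i)//= [X in _ + X]big1 ?addr0// => l li.
  by rewrite v0// mulmx0.
have := @descent _ _ f x v (L i * enorm (block i v) ^+ 2) df.
rewrite dv => /(_ _)/le_trans; apply; last by rewrite mulrAC.
move=> c /andP[c0 c1]; rewrite dv blockB.
have -> : c *: v = U i *m (c *: block i v) by rewrite -scalemxAr -vE.
apply: (le_trans (Cauchy_Schwarz _ _)).
have := Lf x i (c *: block i v); rewrite -enormN opprB enormZ gtr0_norm// => H.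
apply: (le_trans (ler_wpM2r (enorm_ge0 _) H)).
by rewrite le_eqVlt; apply/orP; left; apply/eqP; ring.
Qed.

End blocks_theory.

(** * Convex functions *)

Section convex.
Context {R : realType}.

(** Dividing by [s] and letting [s] tend to [0] turns the first-order
    optimality of a minimizer along a segment into quadratic growth. *)
Lemma growth_of_segment (a b k : R) :
  (forall s : R, 0 < s < 1 -> a <= s * b + (1 - s) * a - k * s * (1 - s)) ->
  a + k <= b.
Proof.
move=> H; rewrite leNgt; apply/negP => ab.
have {}H s : 0 < s < 1 -> k * (1 - s) <= b - a.
  move=> s01; have /andP[s0 s1] := s01.
  rewrite -(ler_pM2l s0); have := H s s01; lra.
have k0 : 0 < a + k - b by rewrite subr_gt0.
have [kpos|kneg] := ltrP 0 k; last first.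
  have /H : 0 < (1/2 : R) < 1 by lra.
  move: kneg ab; lra.
pose s := Num.min (1/2) ((a + k - b) / (2 * k)).
have s0 : 0 < s by rewrite /s lt_min !divr_gt0 ?mulr_gt0.
have s12 : s <= 1/2 by rewrite ge_min lexx.
have sk : s * (2 * k) <= a + k - b.
  by rewrite -ler_pdivlMr ?mulr_gt0// ge_min lexx orbT.
have /H : 0 < s < 1 by lra.
lra.
Qed.

Context {n : nat}.
Implicit Types (g : 'cV[R]_n -> \bar R) (x y : 'cV[R]_n).

Lemma econvex_fine g x y (s : R) : eproper g -> econvex g ->
  g x \is a fin_num -> g y \is a fin_num -> 0 <= s <= 1 ->
  g (s *: x + (1 - s) *: y) \is a fin_num /\
  fine (g (s *: x + (1 - s) *: y)) <= s * fine (g x) + (1 - s) * fine (g y).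
Proof.
move=> [gN _] cg gx gy /andP[].
rewrite le_eqVlt => /predU1P[<- _|s0].
  by rewrite scale0r add0r subr0 scale1r mul0r add0r mul1r.
rewrite le_eqVlt => /predU1P[->|s1].
  by rewrite subrr scale0r addr0 scale1r mul0r addr0 mul1r.
have := cg x y s; rewrite s0 s1 => /(_ isT).
rewrite -{1}(fineK gx) -{1}(fineK gy) -!EFinM -EFinD => H.
have gF : g (s *: x + (1 - s) *: y) \is a fin_num.
  by apply: fin_real; rewrite gN/= (le_lt_trans H)// ltry.
by split => //; rewrite -lee_fin fineK.
Qed.

End convex.

Lemma ltNy_add {R : realDomainType} (a b : \bar R) :
  (-oo < a -> -oo < b -> -oo < a + b)%E.
Proof. by move: a b => [a| |] [b| |]; rewrite ?ltNyr ?ltxx. Qed.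

(** * Separable functions and the block update *)

Section separable.
Context {R : realType} {m : nat} {d : 'I_m -> nat}.
Local Notation D := (\sum_(i < m) d i)%N.
Variable phi : forall i, 'cV[R]_(d i) -> \bar R.
Arguments phi : clear implicits.
Hypothesis phi_proper : forall i, eproper (phi i).
Hypothesis phi_convex : forall i, econvex (phi i).
Implicit Types (u v x y : 'cV[R]_D).

Definition sdom x : Prop := forall i, phi i (block i x) \is a fin_num.

Definition ssum x : R := \sum_i fine (phi i (block i x)).

Lemma separableE x : sdom x -> separable phi x = (ssum x)%:E.
Proof.
by move=> dx; rewrite /separable -sumEFin; apply: eq_bigr => i _; rewrite fineK.
Qed.

Lemma separable_gtNy x : (-oo < separable phi x)%E.
Proof.
rewrite /separable; apply: (big_ind (fun e => -oo < e)%E) => //.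
- exact: ltNy_add.
- by move=> i _; have [+ _] := phi_proper i; exact.
Qed.

Lemma separable_sdom x : (separable phi x < +oo)%E -> sdom x.
Proof.
move=> xoo i; have [phiN _] := phi_proper i; apply: fin_real.
rewrite phiN/= ltNge leye_eq; apply/eqP => phiy; move: xoo.
rewrite /separable (bigD1 i)//= phiy addye ?ltxx//.
rewrite gt_eqF//; apply: (big_ind (fun e => -oo < e)%E) => //.
- exact: ltNy_add.
- by move=> j _; have [+ _] := phi_proper j; exact.
Qed.

Lemma sdom_conv x y (s : R) : sdom x -> sdom y -> 0 <= s <= 1 ->
  sdom (s *: x + (1 - s) *: y).
Proof.
move=> dx dy s01 i; rewrite blockD !blockZ.
by have [] := econvex_fine (phi_proper i) (@phi_convex i) (dx i) (dy i) s01.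
Qed.

Lemma ssum_conv x y (s : R) : sdom x -> sdom y -> 0 <= s <= 1 ->
  ssum (s *: x + (1 - s) *: y) <= s * ssum x + (1 - s) * ssum y.
Proof.
move=> dx dy s01; rewrite /ssum !mulr_sumr -big_split; apply: ler_sum => i _ /=.
rewrite blockD !blockZ.
by have [] := econvex_fine (phi_proper i) (@phi_convex i) (dx i) (dy i) s01.
Qed.

Lemma sdom_ex : exists x, sdom x.
Proof.
have ex i : exists v : 'cV[R]_(d i), phi i v \is a fin_num.
  have [phiN [v vy]] := phi_proper i; exists v; exact/fin_real/andP.
exists (\mxcol_i sval (cid (ex i))) => i; rewrite blockE mxcolK.
exact: svalP (cid (ex i)).
Qed.

End separable.

Lemma leD_fine {R : realDomainType} (x y : \bar R) (a b : R) :
  x \is a fin_num -> (a%:E + x <= b%:E + y)%E -> y \is a fin_num ->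
  a + fine x <= b + fine y.
Proof. by move: x y => [x| |] [y| |]. Qed.

Section block_prox.
Context {R : realType} {m : nat} {d : 'I_m -> nat}.
Local Notation D := (\sum_(i < m) d i)%N.
Variable phi : forall i, 'cV[R]_(d i) -> \bar R.
Arguments phi : clear implicits.
Hypothesis phi_proper : forall i, eproper (phi i).
Hypothesis phi_convex : forall i, econvex (phi i).

(** The block update of APCG: the argmin keeps the prox centre [c] outside the
    sampled block, and inside it satisfies the three-point inequality. *)
Lemma block_prox (Lt : 'I_m -> R) (a : R) (i : 'I_m) (g : 'cV[R]_(d i)) (c z : 'cV[R]_D) :
  0 < a -> (forall l, 0 < Lt l) ->
  is_argmin (fun x => (a * wnorm Lt (x - c) ^+ 2 + dotv g (block i x))%:E
                      + phi i (block i x))%E z ->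
  [/\ phi i (block i z) \is a fin_num,
      forall l, l != i -> block l z = block l c &
      forall u : 'cV[R]_(d i), phi i u \is a fin_num ->
        a * Lt i * enorm (block i z - block i c) ^+ 2 + dotv g (block i z)
          + fine (phi i (block i z)) + a * Lt i * enorm (u - block i z) ^+ 2
        <= a * Lt i * enorm (u - block i c) ^+ 2 + dotv g u + fine (phi i u)].
Proof.
move=> a0 Lt0 zmin.
have Lt0' l : 0 <= Lt l by exact: ltW.
pose pt (u : 'cV[R]_(d i)) := c + U i *m (u - block i c).
have pti (u : 'cV[R]_(d i)) : block i (pt u) = u by rewrite blockD block_U addrC subrK.
have ptw (u : 'cV[R]_(d i)) : wnorm Lt (pt u - c) ^+ 2 = Lt i * enorm (u - block i c) ^+ 2.
  rewrite (@wnorm_sqr1 _ _ _ _ i)// => [|l li]; first by rewrite blockB pti.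
  by rewrite blockB blockD block_U_neq// addr0 subrr.
(* [pt u] is [c] with block [i] replaced by [u]; such points alone are compared
   with the minimizer. *)
clearbody pt; have [phiN [u0 u0y]] := phi_proper i.
have zF : phi i (block i z) \is a fin_num.
  apply: fin_real; rewrite phiN/= ltNge leye_eq; apply/eqP => zy.
  have := zmin (pt u0); rewrite zy addey// pti leye_eq.
  have u0F : phi i u0 \is a fin_num by apply: fin_real; rewrite phiN.
  by rewrite -(fineK u0F) -EFinD.
have H (u : 'cV[R]_(d i)) : phi i u \is a fin_num ->
    a * wnorm Lt (z - c) ^+ 2 + dotv g (block i z) + fine (phi i (block i z))
    <= a * (Lt i * enorm (u - block i c) ^+ 2) + dotv g u + fine (phi i u).
  move=> uF; have := zmin (pt u).
  move=> /(leD_fine zF); rewrite pti.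
  move=> /(_ uF).
  by rewrite ptw.
(* Moving the other blocks of [z] back to [c] changes only the quadratic term. *)
have zc l : l != i -> block l z = block l c.
  move=> li; have := H _ zF.
  rewrite (wnorm_sqrD1 i)// [X in Lt i * enorm X ^+ 2]blockB -addrA [leRHS]addrAC -[leRHS]addrA.
  rewrite mulrDr -subr_ge0 => H'.
  have {}H' : a * \sum_(j | j != i) Lt j * enorm (block j (z - c)) ^+ 2 <= 0.
    by move: H'; lra.
  have /eqP : \sum_(j | j != i) Lt j * enorm (block j (z - c)) ^+ 2 = 0.
    apply/eqP; rewrite eq_le sumr_ge0 ?andbT => [|j _]; last first.
      by rewrite mulr_ge0// sqr_ge0.
    by move: H'; rewrite pmulr_rle0.
  rewrite psumr_eq0 => [/allP/(_ l (mem_index_enum l))|j _]; last first.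
    by rewrite mulr_ge0// sqr_ge0.
  rewrite li/= mulf_eq0 gt_eqF//= enorm_sqr => /eqP/dotvv_eq0/eqP.
  by rewrite blockB subr_eq0 => /eqP.
split => // u uF.
have zw : wnorm Lt (z - c) ^+ 2 = Lt i * enorm (block i z - block i c) ^+ 2.
  rewrite (@wnorm_sqr1 _ _ _ _ i)// => [|l li]; first by rewrite blockB.
  by rewrite blockB zc// subrr.
rewrite zw in H.
apply: growth_of_segment => s s01; have /andP[s0 s1] := s01.
have [|vF vle] := econvex_fine (phi_proper i) (@phi_convex i) uF zF (s := s).
  by rewrite !ltW.
apply: (le_trans _ (le_trans (H _ vF) _)); first by rewrite !mulrA.
have -> : s *: u + (1 - s) *: block i z - block i c =
          s *: (u - block i c) + (1 - s) *: (block i z - block i c).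
  by apply/matrixP => j k; rewrite !mxE; ring.
rewrite enorm_sqr_conv !dotvDr !dotvZr.
have -> : u - block i c - (block i z - block i c) = u - block i z.
  by rewrite opprB addrA subrK.
move: vle; lra.
Qed.

End block_prox.

(** * Existence of minimizers *)

Section argmin.
Context {R : realType}.

Lemma cvg_mx {T : Type} {p q : nat} (F : set_system T) (FF : Filter F)
    (f : T -> 'M[R]_(p, q)) (l : 'M[R]_(p, q)) :
  (forall i j, (fun t => f t i j) @ F --> l i j) -> f @ F --> l.
Proof.
move=> H; apply/cvg_ballP => e e0.
have : \forall t \near F, forall i j, ball (l i j) e (f t i j).
  apply: filter_forall => i; apply: filter_forall => j.
  by have /cvg_ballP := H i j; apply.
by apply: filterS => t Ht; split.
Qed.

Lemma continuous_mulmx {p q : nat} (A : 'M[R]_(p, q)) :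
  continuous (fun x : 'cV[R]_q => A *m x).
Proof.
move=> x; apply: (@cvg_mx _ _ _ (nbhs x)) => i j.
have -> : (fun t : 'cV[R]_q => (A *m t) i j) = (fun t => \sum_k A i k * t k j).
  by apply/funext => t; rewrite mxE.
rewrite mxE; apply: continuous_big => [|k _ {}x]; first exact: add_continuous.
have Hc : {for x, continuous (fun x : 'cV[R]_q => x k j)} by exact: coord_continuous.
exact: (continuousM (@cst_continuous _ _ (A i k) x) Hc).
Qed.

Lemma bounded_sub_compact {n : nat} (A : set 'cV[R]_n) : bounded_set A ->
  exists2 B, compact B & A `<=` B.
Proof.
move=> [M [Mreal AM]].
pose N := M + 1.
exists (trmx @` [set v : 'rV[R]_n | forall i, v ord0 i \in `[- N, N]]).
  apply: continuous_compact.
    apply: continuous_subspaceT => x; apply: (@cvg_mx _ _ _ (nbhs x)) => i j.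
    have -> : (fun t : 'rV[R]_n => t^T i j) = (fun t => t j i).
      by apply/funext => t; rewrite mxE.
    rewrite mxE; exact: coord_continuous.
  apply: (@rV_compact _  _ (fun=> `[- N, N]%classic)).
  by move=> _; apply: segment_compact.
move=> v /(AM N) vN; exists v^T; last by rewrite trmxK.
move=> i /=; rewrite mxE in_itv/= -ler_norml.
apply: le_trans (vN _); last by rewrite ltrDl.
rewrite [leRHS]/Num.norm/= mx_normrE.
exact: (@le_bigmax_cond _ _ _ _ (i, ord0) _ (fun ij => `|v ij.1 ij.2|)).
Qed.

(** The sublevel sets of [g] generate a filter that contains a compact set. If
    there were no minimizer, a cluster point [p] would have points [v], [w] with
    [g w < g v < g p], and lower semicontinuity keeps the sublevel set of [w]
    away from [p]. *)
Lemma lsc_argmin {n : nat} (g : 'cV[R]_n -> \bar R) x0 :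
  lower_semicontinuous g -> (g x0 < +oo)%E ->
  (forall r, bounded_set [set u | (g u <= r%:E)%E]) ->
  exists p, is_argmin g p.
Proof.
move=> glsc gx0 gb.
have [r gx0r] : exists r : R, (g x0 <= r%:E)%E.
  by move: gx0; case: (g x0) => [r _| |_]; [exists r|rewrite ltxx|exists 0; rewrite leNye].
have [B cB gB] := bounded_sub_compact (gb r).
apply: contrapT => nomin.
have H u : exists v, (g v < g u)%E.
  apply: contrapT => nv; apply: nomin; exists u => v.
  by rewrite leNgt; apply/negP => gvu; apply: nv; exists v.
pose F := filter_from [set: 'cV[R]_n] (fun u => [set v | (g v <= g u)%E]).
have FF : ProperFilter F.
  apply: filter_from_proper; last by move=> u _; exists u => /=.
  apply: filter_from_filter; first by exists 0.
  move=> u v _ _; have [uv|/ltW vu] := leP (g u) (g v).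
    by exists u => // w /= wu; split => //; exact: le_trans uv.
  by exists v => // w /= wu; split => //; exact: le_trans vu.
have FB : F B by exists x0 => // v /= vx0; apply: gB; exact: le_trans gx0r.
have [p [_ clp]] := cB _ FF FB.
have [v gvp] := H p; have [w gwv] := H v.
have [a wa ap] : exists2 a : R, (g w <= a%:E)%E & (a%:E < g p)%E.
  move: gwv gvp; case: (g v) => [a| |]; last by case: (g w).
    by exists a => //; exact: ltW.
  by move=> _; rewrite ltNge leey.
have [V nV VP] := glsc p a ap.
have [y [/= yw /VP]] : [set v | (g v <= g w)%E] `&` V !=set0.
  by apply: clp => //; exists w.
by rewrite ltNge (le_trans yw wa).
Qed.

End argmin.

Section lsc.
Context {R : realType} {T : topologicalType}.
Implicit Types g : T -> \bar R.

Lemma lsc_add g1 g2 : (forall x, -oo < g1 x)%E -> (forall x, -oo < g2 x)%E ->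
  lower_semicontinuous g1 -> lower_semicontinuous g2 ->
  lower_semicontinuous (fun x => g1 x + g2 x)%E.
Proof.
move=> g1N g2N l1 l2 x a ax.
have [b [c [bx cx abc]]] : exists b c : R, [/\ (b%:E < g1 x)%E, (c%:E < g2 x)%E & a <= b + c].
  move: ax (g1N x) (g2N x); case: (g1 x) => [r| |]; case: (g2 x) => [s| |]//.
  - rewrite -EFinD lte_fin => ars _ _.
    exists (r - (r + s - a) / 2), (s - (r + s - a) / 2); rewrite !lte_fin; split; lra.
  - move=> _ _ _; exists (r - 1), (a - r + 1); rewrite lte_fin ltry; split => //; lra.
  - move=> _ _ _; exists (a - s + 1), (s - 1); rewrite lte_fin ltry; split => //; lra.
  - by move=> _ _ _; exists a, 0; rewrite !ltry; split => //; lra.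
have [V1 nV1 H1] := l1 _ _ bx; have [V2 nV2 H2] := l2 _ _ cx.
exists (V1 `&` V2); first exact: filterI.
move=> y [/H1 y1 /H2 y2]; apply: (@le_lt_trans _ _ (b%:E + c%:E)%E).
  by rewrite -EFinD lee_fin.
exact: lteD.
Qed.

Lemma lsc_sum (J : eqType) (r : seq J) (g : J -> T -> \bar R) :
  (forall j x, -oo < g j x)%E -> (forall j, lower_semicontinuous (g j)) ->
  lower_semicontinuous (fun x => \sum_(j <- r) g j x)%E.
Proof.
move=> gN gl; elim: r => [|j r IH].
  move=> x a; rewrite big_nil => a0; exists setT; first exact: filterT.
  by move=> y _; rewrite big_nil.
have -> : (fun x => \sum_(k <- j :: r) g k x)%E =
          (fun x => g j x + \sum_(k <- r) g k x)%E.
  by apply/funext => x; rewrite big_cons.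
apply: lsc_add => // x; apply: (big_ind (fun e => -oo < e)%E) => //.
exact: ltNy_add.
Qed.

Lemma lsc_continuous (h : T -> R) : continuous h ->
  lower_semicontinuous (fun x => (h x)%:E).
Proof.
move=> ch x a; rewrite lte_fin => ax.
exists [set y | a < h y]; last by move=> y /=; rewrite lte_fin.
exact: (cvgr_gt _ (ch x)).
Qed.

Lemma lsc_comp {S : topologicalType} (h : S -> T) g : continuous h ->
  lower_semicontinuous g -> lower_semicontinuous (g \o h).
Proof.
move=> ch gl x a ax; have [V nV VP] := gl _ _ ax.
by exists (h @^-1` V); [exact: ch|move=> y; exact: VP].
Qed.

End lsc.

(** * One step of APCG *)

Section apcg_step.
Context {R : realType} {m : nat} {d : 'I_m -> nat}.
Local Notation D := (\sum_(i < m) d i)%N.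
Local Notation V := 'cV[R]_D.
Variables (f : V -> R) (phi : forall i, 'cV[R]_(d i) -> \bar R).
Arguments phi : clear implicits.
Variables (Lt : 'I_m -> R) (mut : R).
Hypothesis phi_proper : forall i, eproper (phi i).
Hypothesis phi_convex : forall i, econvex (phi i).
Hypothesis Lt_gt0 : forall i, 0 < Lt i.
Hypothesis m_gt0 : (0 < m)%N.
Hypothesis mut_gt0 : 0 < mut.
Hypothesis mut_lt1 : mut < 1.
Hypothesis f_descent : forall (x v : V) i, (forall l, l != i -> block l v = 0) ->
  f (x + v) <= f x + dotv (block i (grad f x)) (block i v)
               + Lt i / 2 * enorm (block i v) ^+ 2.
Hypothesis f_convex : forall x u : V,
  f x + dotv (grad f x) (u - x) + mut / 2 * wnorm Lt (u - x) ^+ 2 <= f u.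

Local Notation dom := (sdom phi).
Local Notation Phi := (ssum phi).
Local Notation N2 x := (wnorm Lt x ^+ 2).

(** [sub_comb c q Q] holds for [q] a combination of points of the domain with
    nonnegative weights of total [c], and [Q] the same combination of the values
    of [Phi]. Jensen's inequality, in the form in which it is used after
    completing the combination by one more point, stands for the list of points
    and weights. *)
Definition sub_comb (c : R) (q : V) (Q : R) : Prop := forall p (s : R), dom p -> 0 < s ->
  dom ((s + c)^-1 *: (s *: p + q)) /\
  (s + c) * Phi ((s + c)^-1 *: (s *: p + q)) <= s * Phi p + Q.

Lemma sub_comb0 : sub_comb 0 0 0.
Proof.
move=> p s dp s0; rewrite !addr0 scalerA mulVf ?gt_eqF// scale1r.
by split.
Qed.

Lemma sub_combZ (k : R) c q Q : 0 <= k -> sub_comb c q Q ->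
  sub_comb (k * c) (k *: q) (k * Q).
Proof.
rewrite le_eqVlt => /predU1P[<- _|k0 H p s dp s0].
  by rewrite scale0r !mul0r; exact: sub_comb0.
have [|h1 h2] := H p (s / k) dp; first by rewrite divr_gt0.
have sE : k * (s / k) = s by rewrite mulrC divfK ?gt_eqF.
have E1 : s + k * c = k * (s / k + c) by rewrite mulrDr sE.
have E : (s + k * c)^-1 *: (s *: p + k *: q) =
    (s / k + c)^-1 *: ((s / k) *: p + q).
  have -> : s *: p + k *: q = k *: ((s / k) *: p + q).
    by rewrite scalerDr scalerA sE.
  by rewrite E1 scalerA invfM mulrAC mulVf ?gt_eqF// mul1r.
rewrite E E1; split => //.
have -> : s * Phi p + k * Q = k * (s / k * Phi p + Q) by rewrite mulrDr mulrA sE.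
by rewrite -mulrA ler_pM2l.
Qed.

Lemma sub_combD (k c : R) q Q z : 0 <= k -> 0 <= c -> dom z -> sub_comb c q Q ->
  sub_comb (c + k) (k *: z + q) (k * Phi z + Q).
Proof.
move=> k0 c0 dz H p s dp s0.
have sk : 0 < s + k by rewrite ltr_wpDr.
pose b := s / (s + k).
have b01 : 0 <= b <= 1.
  by rewrite /b divr_ge0 ?(ltW s0) ?(ltW sk)//= ler_pdivrMr// mul1r lerDl.
pose p' := b *: p + (1 - b) *: z.
have dp' : dom p' by exact: sdom_conv.
have b1 : 1 - b = k / (s + k).
  by rewrite -[1](@divff _ (s + k)) ?gt_eqF// -mulrBl [s + k]addrC addrK.
have sb : (s + k) * b = s by rewrite mulrC divfK ?gt_eqF.
have sb1 : (s + k) * (1 - b) = k by rewrite b1 mulrC divfK ?gt_eqF.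
clearbody b.
have [h1 h2] := H p' (s + k) dp' sk.
have E : (s + k) *: p' + q = s *: p + (k *: z + q).
  by rewrite /p' scalerDr !scalerA sb sb1 addrA.
rewrite E -!addrA (addrC k) in h1 h2.
split => //; apply: (le_trans h2); rewrite addrA lerD2r.
have /(ler_wpM2l (ltW sk)) := ssum_conv phi_proper phi_convex dp dz b01.
by move=> h; apply: (le_trans h); rewrite mulrDr !mulrA sb sb1.
Qed.

(** [Psi] majorizes [Phi w]. It is linear in the values of [Phi] at the
    points [z] of the run, which makes its conditional expectation computable;
    [w] itself is a convex combination of these points, and the weight of the
    last one stays above [sqrt g]. *)
Definition apcg_state (g : R) (w z : V) (Psi : R) : Prop :=
  exists th q Q, [/\ dom z, w = th *: z + q, Psi = th * Phi z + Q,
    Num.sqrt g <= th <= 1 & sub_comb (1 - th) q Q].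

Lemma apcg_state0 g w : dom w -> g <= 1 -> apcg_state g w w (Phi w).
Proof.
move=> dw g1; exists 1, 0, 0; rewrite subrr scale1r !addr0 mul1r lexx andbT.
split => //; last exact: sub_comb0.
by rewrite -sqrtr1 ler_wsqrtr.
Qed.

Lemma apcg_state_le g w z Psi : 0 < g -> apcg_state g w z Psi ->
  dom w /\ Phi w <= Psi.
Proof.
move=> g0 [th [q [Q [dz -> -> /andP[gth th1] H]]]].
have th0 : 0 < th by rewrite (lt_le_trans _ gth)// sqrtr_gt0.
by have [] := H z th dz th0; rewrite addrC subrK invr1 scale1r mul1r.
Qed.

Definition apcg_step (g : R) (w z : V) (i : 'I_m) (al be g' : R) (y w' z' : V)
  : Prop :=
  [/\ 0 < al <= m%:R^-1 /\
          m%:R ^+ 2 * al ^+ 2 = (1 - al) * g + al * mut,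
          g' = (1 - al) * g + al * mut /\
          be = al * mut / g',
          y = (al * g + g')^-1 *: ((al * g) *: z + g' *: w),
          is_argmin (fun x : V =>
            (m%:R * al / 2 *
               wnorm Lt (x - (1 - be) *: z - be *: y) ^+ 2 +
             dotv (block i (grad f y)) (block i x))%:E
            + phi i (block i x))%E z' &
          w' = y + (m%:R * al) *: (z' - z)
                   + (mut / m%:R) *: (z - y)].

(** Fix the parameters of the step and let the sampled block vary. All the
    [z' i] agree with the prox centre [c] except in block [i], where they agree
    with one full update [zt]; so the sums over [i] of [f (w' i)], of
    [|z' i - u|^2] and of [Phi (z' i)] are affine in quantities that belong to
    [c] and [zt] alone. The three-point inequalities of the blocks add up to the
    one for [zt], and convexity of [f] at [y] towards [u] and [w] does the
    rest. *)
Lemma apcg_step_state g w z Psi al be g' y (w' z' : 'I_m -> V) :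
  mut <= g -> apcg_state g w z Psi ->
  (forall i, apcg_step g w z i al be g' y (w' i) (z' i)) ->
  exists Psi' : 'I_m -> R,
    (forall i, apcg_state g' (w' i) (z' i) (Psi' i)) /\
    forall u, dom u ->
      \sum_i (f (w' i) + Psi' i + g' / 2 * N2 (z' i - u)) <=
      m%:R * ((1 - al) * (f w + Psi + g / 2 * N2 (z - u)) + al * (f u + Phi u)).
Proof.
move=> mutg [th [q [Q [dz wE PsiE /andP[gth th1] HQ]]]] st.
pose i0 := Ordinal m_gt0.
have [[/andP[al0 alm] alE] [g'E beE] yE _ _] := st i0.
set M : R := m%:R in alm alE *.
have M0 : 0 < M by rewrite ltr0n.
have M1 : 1 <= M by rewrite ler1n.
have Lt0 i : 0 <= Lt i by exact: ltW.
have g0 : 0 < g by exact: lt_le_trans mutg.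
have Mal1 : M * al <= 1 by rewrite -(divff (lt0r_neq0 M0)) ler_pM2l.
have al1 : al <= 1 by rewrite (le_trans alm)// invf_le1.
have g'M : g' = M ^+ 2 * al ^+ 2 by rewrite alE.
have g'0 : 0 < g' by rewrite g'M mulr_gt0// exprn_gt0.
have alg0 : 0 < al * g + g' by rewrite addr_gt0// mulr_gt0.
have Mth : M * al <= th.
  have Mal0 : 0 <= M * al by rewrite mulr_ge0 ?(ltW M0) ?(ltW al0).
  apply: le_trans gth; rewrite -[leLHS]ger0_norm//.
  rewrite -sqrtr_sqr ler_wsqrtr// exprMn -g'M g'E.
  have : al * mut <= al * g by rewrite ler_pM2l.
  lra.
(* [y] is the combination of [z] and [w] with weights [a] and [1 - a]; the
   identities [K1], [K2] and [K3] make the coefficients of [z], [w] and of the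
   linear term match. *)
pose a := al * g / (al * g + g').
have a0 : 0 <= a by rewrite /a ltW// divr_gt0// mulr_gt0.
have a1 : a <= 1 by rewrite /a ler_pdivrMr// mul1r lerDl ltW.
have yE' : y = a *: z + (1 - a) *: w.
  rewrite yE scalerDr !scalerA [_^-1 * _]mulrC -/a; congr (_ + _ *: _).
  by rewrite /a; field; rewrite gt_eqF.
have gbe : g' * be = al * mut by rewrite beE mulrC divfK ?gt_eqF.
have K2 : M * al * be = mut / M.
  by rewrite beE g'M; field; rewrite !gt_eqF.
have K1 : (1 - a) * (1 - al * be) = 1 - al.
  have -> : 1 - a = g' / (al * g + g').
    by rewrite /a; field; rewrite gt_eqF.
  rewrite beE; apply: (mulIf (lt0r_neq0 alg0)).
  have -> : g' / (al * g + g') * (1 - al * (al * mut / g')) * (al * g + g') =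
            g' - al ^+ 2 * mut by field; rewrite !gt_eqF.
  rewrite g'E; ring.
have be0 : 0 <= be by rewrite beE divr_ge0 ?mulr_ge0// ltW.
have be1 : be <= 1.
  rewrite beE ler_pdivrMr// mul1r g'E lerDr mulr_ge0 ?subr_ge0// ltW//.
have al01 : 0 <= 1 - al by rewrite subr_ge0.
have [dw Phiw] := apcg_state_le g0 (ex_intro _ th (ex_intro _ q (ex_intro _ Q
  (And5 dz wE PsiE (introT andP (conj gth th1)) HQ)))).
have a01 : 0 <= a <= 1 by rewrite a0.
have dy : dom y by rewrite yE'; exact: sdom_conv.
have Phiy : Phi y <= a * Phi z + (1 - a) * Psi.
  rewrite yE'; apply: (le_trans (ssum_conv phi_proper phi_convex dz dw a01)).
  by rewrite lerD2l ler_wpM2l// subr_ge0.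
clearbody a; pose c := (1 - be) *: z + be *: y.
have cD : c = (1 - be) *: z + be *: y by [].
have be01 : 0 <= 1 - be <= 1 by rewrite subr_ge0 be1 gerBl.
have cE : c = (1 - be) *: z + (1 - (1 - be)) *: y by rewrite subKr.
have dc : dom c by rewrite cE; exact: sdom_conv.
have Phic : Phi c <= (1 - be) * Phi z + be * Phi y.
  rewrite cE; have := ssum_conv phi_proper phi_convex dz dy be01.
  by rewrite subKr.
have P i : [/\ phi i (block i (z' i)) \is a fin_num,
      forall l, l != i -> block l (z' i) = block l c &
      forall u : 'cV[R]_(d i), phi i u \is a fin_num ->
        M * al / 2 * Lt i * enorm (block i (z' i) - block i c) ^+ 2
          + dotv (block i (grad f y)) (block i (z' i))
          + fine (phi i (block i (z' i)))
          + M * al / 2 * Lt i * enorm (u - block i (z' i)) ^+ 2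
        <= M * al / 2 * Lt i * enorm (u - block i c) ^+ 2
           + dotv (block i (grad f y)) u + fine (phi i u)].
  have [_ _ _ zmin _] := st i.
  have zmin' : is_argmin (fun x : V => (M * al / 2 * wnorm Lt (x - c) ^+ 2
      + dotv (block i (grad f y)) (block i x))%:E + phi i (block i x))%E (z' i).
    move=> x; have := zmin x; have E (v : V) : v - (1 - be) *: z - be *: y = v - c.
      by rewrite /c opprD addrA.
    by rewrite !E.
  have Mal2 : 0 < M * al / 2 by rewrite divr_gt0// mulr_gt0.
  exact: (block_prox phi_proper phi_convex Mal2 Lt_gt0 zmin').
clearbody c.
pose zt : V := \mxcol_i block i (z' i).
have ztb i : block i zt = block i (z' i) by rewrite blockE mxcolK.
clearbody zt.
have dzt : dom zt by move=> i; rewrite ztb; have [] := P i.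
have dz' i : dom (z' i).
  by have [zi zl _] := P i => l; have [->//|/zl->] := eqVneq l i; exact: dc.
have wz i : w' i = y + (M * al) *: (z' i - c).
  have [_ _ _ _ ->] := st i; rewrite -/M -addrA; congr (_ + _).
  have -> : mut / M = M * al * be by rewrite K2.
  by rewrite cD; apply/matrixP => j k; rewrite !mxE; ring.
have fw i : f (w' i) <= f y + M * al * dotv (block i (grad f y)) (block i (zt - c))
    + M ^+ 2 * al ^+ 2 / 2 * (Lt i * enorm (block i (zt - c)) ^+ 2).
  have [_ zl _] := P i; rewrite wz.
  apply: le_trans (f_descent _ (i := i) _) _.
    by move=> l li; rewrite blockZ blockB zl// subrr scaler0.
  rewrite blockZ !blockB ztb dotvZr enormZ exprMn real_normK ?num_real//.
  by rewrite le_eqVlt; apply/orP; left; apply/eqP; ring.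
have N2z i u : N2 (z' i - u) = N2 (c - u) +
    (Lt i * enorm (block i (zt - u)) ^+ 2 - Lt i * enorm (block i (c - u)) ^+ 2).
  have [_ zl _] := P i.
  rewrite !(wnorm_sqrD1 i _ Lt0) (_ : block i (zt - u) = block i (z' i - u)); last first.
    by rewrite !blockB ztb.
  rewrite (eq_bigr (fun l => Lt l * enorm (block l (c - u)) ^+ 2)); last first.
    by move=> l li; rewrite !blockB zl.
  ring.
have Phiz i : Phi (z' i) = Phi c + (fine (phi i (block i zt)) - fine (phi i (block i c))).
  have [_ zl _] := P i.
  rewrite /ssum [LHS](bigD1 i)//= [in RHS](bigD1 i)//= ztb.
  rewrite [in LHS](eq_bigr (fun l => fine (phi l (block l c)))); last first.
    by move=> l li; rewrite zl.
  ring.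
(* The weights of the representation of [w' i]: it puts [M * al] on [z' i],
   [cz] on [z] and the factor [cv] on the previous remainder [q]. *)
pose cz := mut / M - M * al + (1 - mut / M) * (a + (1 - a) * th).
pose cv := (1 - mut / M) * (1 - a).
have mutM : mut / M <= 1 by rewrite ler_pdivrMr// mul1r (le_trans (ltW mut_lt1)).
have mutM0 : 0 <= mut / M by rewrite divr_ge0// ltW.
have cv0 : 0 <= cv by rewrite /cv mulr_ge0 ?subr_ge0.
have cz0 : 0 <= cz.
  have h1 : th <= a + (1 - a) * th.
    have : 0 <= a * (1 - th) by rewrite mulr_ge0// subr_ge0.
    lra.
  have h2 : (1 - mut / M) * th <= (1 - mut / M) * (a + (1 - a) * th).
    by rewrite ler_wpM2l// subr_ge0.
  have h3 : 0 <= mut / M * (1 - th) by rewrite mulr_ge0// subr_ge0.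
  rewrite /cz; move: h2 h3; set X := _ * (a + _); set Y := mut / M; lra.
exists (fun i => M * al * Phi (z' i) + (cz * Phi z + cv * Q)); split.
  move=> i; exists (M * al), (cz *: z + cv *: q), (cz * Phi z + cv * Q); split => //.
  - rewrite wz cD; rewrite yE' wE.
    have -> : z' i - ((1 - be) *: z + be *: (a *: z + (1 - a) *: (th *: z + q)))
        = z' i - z + be *: z - be *: (a *: z + (1 - a) *: (th *: z + q)).
      by apply/matrixP => j k; rewrite !mxE; ring.
    rewrite scalerBr.
    have -> : (M * al) *: (z' i - z + be *: z) = (M * al) *: (z' i - z) + (mut / M) *: z.
      by rewrite scalerDr scalerA K2.
    rewrite scalerA K2 /cz /cv.
    by apply/matrixP => j k; rewrite !mxE; ring.
  - rewrite Mal1 andbT g'M -exprMn sqrtr_sqr ger0_norm// mulr_ge0// ltW//.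
  - have -> : 1 - M * al = cv * (1 - th) + cz by rewrite /cv /cz; ring.
    apply: sub_combD => //; first by rewrite mulr_ge0// subr_ge0.
    exact: sub_combZ.
move=> u du.
set G := grad f y in fw P *.
have SG (v : V) : \sum_i dotv (block i G) (block i v) = dotv G v by rewrite -dotv_block.
have SN (v : V) : \sum_i Lt i * enorm (block i v) ^+ 2 = N2 v by rewrite wnorm_sqr.
(* [S1] to [S4] are the summed estimates, [T1] to [T6] the same facts with the
   weights they carry in the final linear combination. *)
have S1 : \sum_i f (w' i) <= M * f y + M * al * dotv G (zt - c)
    + M ^+ 2 * al ^+ 2 / 2 * N2 (zt - c).
  apply: (le_trans (ler_sum _ (fun i _ => fw i))).
  rewrite !big_split/= sumr_const card_ord -[_ *+ m]mulr_natl -!mulr_sumr SG SN.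
  exact: lexx.
have S2 : \sum_i N2 (z' i - u) = M * N2 (u - c) + (N2 (u - zt) - N2 (u - c)).
  under eq_bigr do rewrite N2z.
  rewrite big_split/= sumrB sumr_const card_ord -[_ *+ m]mulr_natl !SN.
  have sw (v1 v2 : V) : N2 (v1 - v2) = N2 (v2 - v1).
    by rewrite !wnorm_sqr//; apply: eq_bigr => i _; rewrite !blockB dist_sqrC.
  by rewrite (sw zt u) (sw c u).
have S3 : \sum_i Phi (z' i) = M * Phi c + (Phi zt - Phi c).
  under eq_bigr do rewrite Phiz.
  by rewrite big_split/= sumrB sumr_const card_ord -[_ *+ m]mulr_natl.
have S4 : M * al / 2 * N2 (zt - c) + dotv G zt + Phi zt + M * al / 2 * N2 (u - zt)
    <= M * al / 2 * N2 (u - c) + dotv G u + Phi u.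
  rewrite -!SG -!SN /ssum !mulr_sumr -!big_split/=; apply: ler_sum => i _.
  have [_ _ /(_ _ (du i))] := P i.
  by rewrite !blockB !ztb !mulrA.
have S5 : N2 (u - c) <= (1 - be) * N2 (u - z) + be * N2 (u - y).
  have -> : u - c = (1 - be) *: (u - z) + (1 - (1 - be)) *: (u - y).
    by rewrite cD; apply/matrixP => j k; rewrite !mxE; ring.
  apply: (le_trans (wnorm_sqr_conv _ _ Lt0 be01)).
  by rewrite subKr.
have S6 := f_convex y u; rewrite -/G in S6.
have S7 : f y + dotv G (w - y) <= f w.
  apply: le_trans (f_convex y w); rewrite lerDl mulr_ge0 ?divr_ge0 ?sqr_ge0//.
  exact: ltW.
have K3 : al * dotv G (y - c) = (1 - al) * dotv G (w - y).
  rewrite -!dotvZr; congr (dotv _ _).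
  have -> : y - c = (1 - be) *: (y - z).
    by rewrite cD; apply/matrixP => j k; rewrite !mxE; ring.
  have -> : w - y = a *: (w - z).
    by rewrite yE'; apply/matrixP => j k; rewrite !mxE; ring.
  have -> : y - z = (1 - a) *: (w - z).
    by rewrite yE'; apply/matrixP => j k; rewrite !mxE; ring.
  rewrite !scalerA; congr (_ *: _).
  transitivity ((1 - a) * (1 - al * be) - (1 - al) * (1 - a)); first by ring.
  by rewrite K1; ring.
have T1 : al * (M * al / 2 * N2 (zt - c) + dotv G zt + Phi zt + M * al / 2 * N2 (u - zt))
    <= al * (M * al / 2 * N2 (u - c) + dotv G u + Phi u).
  by rewrite ler_pM2l.
have T2 : al * (M - 1) * Phi c <= al * (M - 1) * ((1 - be) * Phi z
    + be * (a * Phi z + (1 - a) * Psi)).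
  apply: ler_wpM2l; first by rewrite mulr_ge0 ?subr_ge0// ltW.
  by apply: (le_trans Phic); rewrite lerD2l ler_wpM2l.
have T3 : al * (M - 1) * ((1 - be) * Phi z + be * (a * Phi z + (1 - a) * Psi))
    + (cz * Phi z + cv * Q) = (1 - al) * Psi.
  transitivity ((1 - a) * (1 - al * be) * Psi
      + Phi z * (1 - al - (1 - a) * (1 - al * be))).
    by rewrite /cz /cv -K2 PsiE; ring.
  by rewrite K1 subrr mulr0 addr0.
have T4 : g' / 2 * N2 (u - c) <= (1 - al) * (g / 2 * N2 (u - z))
    + al * (mut / 2 * N2 (u - y)).
  have -> : (1 - al) * (g / 2 * N2 (u - z)) + al * (mut / 2 * N2 (u - y)) =
      g' / 2 * ((1 - be) * N2 (u - z) + be * N2 (u - y)).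
    have -> : g' / 2 * ((1 - be) * N2 (u - z) + be * N2 (u - y)) =
      ((g' - g' * be) * N2 (u - z) + g' * be * N2 (u - y)) / 2 by ring.
    by rewrite gbe g'E; ring.
  by rewrite ler_wpM2l// ltW// divr_gt0.
have T5 := ler_wpM2l (ltW al0) S6.
have T6 := ler_wpM2l al01 S7.
have sw (v1 v2 : V) : N2 (v1 - v2) = N2 (v2 - v1).
  by rewrite !wnorm_sqr//; apply: eq_bigr => i _; rewrite !blockB dist_sqrC.
rewrite (sw z u) 2!big_split/= big_split/= sumr_const card_ord -!mulr_sumr.
rewrite -[_ *+ m]mulr_natl -/M S2 S3.
apply: (@le_trans _ _ (M * (f y + al * dotv G (zt - c) + M * al ^+ 2 / 2 * N2 (zt - c)
   + (al * (M - 1) * Phi c + al * Phi zt + (cz * Phi z + cv * Q))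
   + (g' / 2 * N2 (u - c) + M * al ^+ 2 / 2 * (N2 (u - zt) - N2 (u - c)))))).
  rewrite g'M; move: S1.
  move: (\sum_i f (w' i)) (dotv G (zt - c)) (N2 (zt - c)) (N2 (u - c)) (N2 (u - zt)).
  move: (f y) (Phi c) (Phi zt) (cz * Phi z + cv * Q).
  by clear; move=> *; lra.
rewrite ler_pM2l//.
rewrite !dotvBr in T1 T5 T6 K3 *.
move: T1 T2 T3 T4 T5 T6 K3.
set b := _ + be * _; move: b (cz * Phi z + cv * Q) => b b'.
move: (N2 (zt - c)) (N2 (u - zt)) (N2 (u - c)) (N2 (u - z)) (N2 (u - y)).
move: (dotv G zt) (dotv G u) (dotv G y) (dotv G c) (dotv G w).
move: (Phi zt) (Phi u) (Phi c) (f y) (f u) (f w); clear.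
by move=> *; lra.
Qed.

End apcg_step.

(** * The parameters of APCG *)

Section parameters.
Context {R : realType}.
Variables (m : nat) (mut : R).
Hypothesis m_gt0 : (0 < m)%N.
Hypothesis mut_gt0 : 0 < mut.
Local Notation M := (m%:R : R).

(** The positive root of [m^2 a^2 = (1 - a) g + a mut]. *)
Definition apcg_alpha (g : R) : R :=
  (Num.sqrt ((g - mut) ^+ 2 + 4 * M ^+ 2 * g) - (g - mut)) / (2 * M ^+ 2).

Definition apcg_next (g : R) : R := (1 - apcg_alpha g) * g + apcg_alpha g * mut.

Let M_gt0 : 0 < M. Proof. by rewrite ltr0n. Qed.
Let M_ge1 : 1 <= M. Proof. by rewrite ler1n. Qed.

Lemma apcg_alphaP g : mut <= g ->
  0 < apcg_alpha g /\
  M ^+ 2 * apcg_alpha g ^+ 2 = (1 - apcg_alpha g) * g + apcg_alpha g * mut.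
Proof.
move=> mutg; have g0 : 0 < g by exact: lt_le_trans mutg.
have M2 : 0 < M ^+ 2 by rewrite exprn_gt0.
have D0 : 0 < 4 * M ^+ 2 * g by rewrite !mulr_gt0.
rewrite /apcg_alpha; set S := Num.sqrt _.
have SE : S ^+ 2 = (g - mut) ^+ 2 + 4 * M ^+ 2 * g.
  by rewrite sqr_sqrtr// addr_ge0 ?sqr_ge0// ltW.
have Sg : g - mut < S.
  have S0 : 0 <= S by exact: sqrtr_ge0.
  have gm0 : 0 <= g - mut by rewrite subr_ge0.
  rewrite ltNge; apply/negP => SL.
  have : S ^+ 2 <= (g - mut) ^+ 2 by rewrite ler_sqr ?nnegrE.
  by rewrite SE gerDl leNgt D0.
split; first by rewrite divr_gt0 ?subr_gt0// mulr_gt0.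
clearbody S; set a := _ / _; have aE : a * (2 * M ^+ 2) = S - (g - mut).
  by rewrite /a divfK// gt_eqF// mulr_gt0.
have E : (a * (2 * M ^+ 2) + (g - mut)) ^+ 2 = (g - mut) ^+ 2 + 4 * M ^+ 2 * g.
  by rewrite aE subrK.
apply: (mulfI (_ : 4 * M ^+ 2 != 0)); first by rewrite gt_eqF// mulr_gt0.
move: E; clear; move=> E; lra.
Qed.

Lemma apcg_alpha_unique g a : mut <= g -> 0 < a ->
  M ^+ 2 * a ^+ 2 = (1 - a) * g + a * mut -> a = apcg_alpha g.
Proof.
move=> mutg a0 aE; have [b0 bE] := apcg_alphaP mutg.
apply/eqP; rewrite -subr_eq0.
have M2 : 0 < M ^+ 2 by rewrite exprn_gt0.
have /eqP : (a - apcg_alpha g) * (M ^+ 2 * (a + apcg_alpha g) + (g - mut)) = 0.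
  by move: aE bE; lra.
rewrite mulf_eq0 => /orP[//|]; rewrite gt_eqF// ltr_wpDr ?subr_ge0//.
by rewrite mulr_gt0// addr_gt0.
Qed.

Lemma apcg_next_bounds g : mut <= g <= 1 ->
  [/\ apcg_next g = (M * apcg_alpha g) ^+ 2, mut <= apcg_next g <= g,
      apcg_next g <= 1 & apcg_alpha g <= 1].
Proof.
move=> /andP[mutg g1]; have [a0 aE] := apcg_alphaP mutg.
rewrite /apcg_next; set a := apcg_alpha g in a0 aE *.
have nE : (1 - a) * g + a * mut = (M * a) ^+ 2 by rewrite exprMn aE.
have ng : (1 - a) * g + a * mut <= g.
  have : 0 <= a * (g - mut) by rewrite mulr_ge0 ?subr_ge0// ltW.
  lra.
have Ma0 : 0 <= M * a by rewrite mulr_ge0// ltW.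
have Ma1 : M * a <= 1.
  by rewrite -(@expr_le1 _ 2%N)// -nE (le_trans ng).
have a1 : a <= 1 by apply: le_trans Ma1; rewrite ler_peMl// ltW.
split => //; last exact: le_trans g1.
rewrite ng andbT.
have : 0 <= (1 - a) * (g - mut) by rewrite mulr_ge0 ?subr_ge0.
lra.
Qed.

Fixpoint apcg_rate (n : nat) (g : R) : R :=
  if n is n'.+1 then (1 - apcg_alpha g) * apcg_rate n' (apcg_next g) else 1.

Lemma iter_next_bounds n g : mut <= g <= 1 -> mut <= iter n apcg_next g <= g.
Proof.
move=> /andP[mg g1]; elim: n => [|n /andP[IH1 IH2]]; first by rewrite mg lexx.
have [|_ /andP[h1 h2] _ _] := @apcg_next_bounds (iter n apcg_next g).
  by rewrite IH1 (le_trans IH2).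
by rewrite iterS h1 (le_trans h2).
Qed.

Lemma apcg_rate_bounds n g : mut <= g <= 1 -> 0 <= apcg_rate n g <= 1.
Proof.
elim: n g => [g _|n IH g gb] /=; first by rewrite ler01 lexx.
have [_ /andP[n1 n2] n3 a1] := apcg_next_bounds gb.
have /andP[r0 r1] : 0 <= apcg_rate n (apcg_next g) <= 1 by apply: IH; rewrite n1.
have a0 : 0 < apcg_alpha g by case/andP: gb => mg _; have [] := apcg_alphaP mg.
rewrite mulr_ge0 ?subr_ge0//= mulr_ile1 ?subr_ge0//.
by rewrite gerBl ltW.
Qed.

Lemma apcg_rate_gamma n g :
  iter n apcg_next g - mut = apcg_rate n g * (g - mut).
Proof.
elim: n g => [g|n IH g] /=; first by rewrite mul1r.
by rewrite -iterS iterSr IH /apcg_next; ring.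
Qed.

(** In the limit of small steps [s = sqrt (g / mut)] follows the flow
    [s' = - (s^2 - 1) / 2], along which [(s - 1) / (s + 1)] decays exponentially
    and the two sides below agree; for a finite step their difference reduces to
    a square. *)
Lemma apcg_next_rate g : mut <= g <= 1 ->
  (1 - apcg_alpha g) * (Num.sqrt g + Num.sqrt mut) ^+ 2 <=
  (1 - Num.sqrt mut / M) * (Num.sqrt (apcg_next g) + Num.sqrt mut) ^+ 2.
Proof.
move=> gb; have [nE /andP[nmut ng] n1 a1] := apcg_next_bounds gb.
have /andP[mg g1] := gb; have [a0 _] := apcg_alphaP mg.
have Ma0 : 0 <= M * apcg_alpha g by rewrite mulr_ge0// ltW.
have sE : Num.sqrt (apcg_next g) = M * apcg_alpha g.
  by rewrite nE sqrtr_sqr ger0_norm.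
have rn : Num.sqrt mut <= Num.sqrt (apcg_next g) by rewrite ler_wsqrtr.
have n1' : Num.sqrt (apcg_next g) <= 1 by rewrite -[leRHS]sqrtr1 ler_wsqrtr.
have r0 : 0 < Num.sqrt mut by rewrite sqrtr_gt0.
have rE : Num.sqrt mut ^+ 2 = mut by rewrite sqr_sqrtr// ltW.
have gE : Num.sqrt g ^+ 2 = g by rewrite sqr_sqrtr// (le_trans _ mg)// ltW.
have s0 : 0 <= Num.sqrt g by exact: sqrtr_ge0.
have nE' : Num.sqrt (apcg_next g) ^+ 2
    = (1 - apcg_alpha g) * Num.sqrt g ^+ 2 + apcg_alpha g * Num.sqrt mut ^+ 2.
  by rewrite gE rE sE -nE.
have aE : apcg_alpha g = Num.sqrt (apcg_next g) / M by rewrite sE mulrC mulKf// gt_eqF.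
move: (Num.sqrt mut) (Num.sqrt g) (Num.sqrt (apcg_next g)) (apcg_alpha g)
  r0 s0 rn n1' nE' aE a0 a1 => r s s' a r0 s0 rs' s'1 E aE a0 a1.
have key : (1 - a) * s <= s' - (s' ^+ 2 + r ^+ 2) / (2 * M).
  have T0 : 0 <= s' - (s' ^+ 2 + r ^+ 2) / (2 * M).
    rewrite subr_ge0 ler_pdivrMr ?mulr_gt0//.
    have s'0 : 0 < s' by exact: lt_le_trans rs'.
    have h1 : s' ^+ 2 <= s' * M by rewrite expr2 ler_pM2l// (le_trans s'1).
    have h2 : r ^+ 2 <= s' * M.
      rewrite expr2; apply: ler_pM => //; try exact: ltW.
      by rewrite (le_trans rs')// (le_trans s'1).
    lra.
  rewrite -ler_sqr ?nnegrE ?mulr_ge0 ?subr_ge0//; last by rewrite -subr_ge0.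
  rewrite exprMn -subr_ge0.
  have -> : (1 - a) ^+ 2 * s ^+ 2 = (1 - a) * (s' ^+ 2 - a * r ^+ 2) by rewrite E; ring.
  have -> : (s' - (s' ^+ 2 + r ^+ 2) / (2 * M)) ^+ 2 - (1 - a) * (s' ^+ 2 - a * r ^+ 2)
     = ((s' ^+ 2 - r ^+ 2) / (2 * M)) ^+ 2.
    by rewrite aE; field; rewrite gt_eqF.
  exact: sqr_ge0.
rewrite -subr_ge0.
have -> : (1 - r / M) * (s' + r) ^+ 2 - (1 - a) * (s + r) ^+ 2 =
   2 * r * (s' - (s' ^+ 2 + r ^+ 2) / (2 * M) - (1 - a) * s).
  have -> : (1 - a) * (s + r) ^+ 2 = s' ^+ 2 - a * r ^+ 2
     + (1 - a) * (2 * s * r + r ^+ 2) by rewrite E; ring.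
  by rewrite aE; field; rewrite gt_eqF.
by rewrite !mulr_ge0 ?subr_ge0// ltW.
Qed.

Lemma apcg_rate_sqrt n g : mut <= g <= 1 -> Num.sqrt mut / M <= 1 ->
  apcg_rate n g * (Num.sqrt g + Num.sqrt mut) ^+ 2 <=
  (1 - Num.sqrt mut / M) ^+ n * (Num.sqrt (iter n apcg_next g) + Num.sqrt mut) ^+ 2.
Proof.
move=> + eta1; elim: n g => [g _|n IH g gb] /=; first by rewrite !mul1r.
have [_ /andP[n1 n2] n3 a1] := apcg_next_bounds gb.
have gb' : mut <= apcg_next g <= 1 by rewrite n1.
have /andP[r0 r1] := apcg_rate_bounds n gb'.
rewrite mulrAC mulrC.
apply: (@le_trans _ _ (apcg_rate n (apcg_next g) * ((1 - Num.sqrt mut / M)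
   * (Num.sqrt (apcg_next g) + Num.sqrt mut) ^+ 2))).
  by rewrite ler_wpM2l// apcg_next_rate.
rewrite mulrCA [_ ^+ n.+1]exprS -[leRHS]mulrA ler_wpM2l ?subr_ge0//.
by apply: (le_trans (IH _ gb')); rewrite -iterS iterSr.
Qed.

(** The final parameter [gn] satisfies [gn / mut = 1 - La + La g / mut], so the
    claim is [(1 - lam) sqrt (gn / mut) <= (1 + lam) (1 - La)]. It follows from
    [apcg_rate_sqrt] and [gn - mut = La (g - mut)], which eliminate [g] up to a
    nonnegative term. *)
Lemma apcg_rate_tradeoff n g (lam := (1 - Num.sqrt mut / M) ^+ n)
    (La := apcg_rate n g) :
  mut <= g <= 1 -> Num.sqrt mut / M <= 1 -> lam <= 1 ->
  (1 - lam) ^+ 2 * (1 - La + La * (g / mut)) <= (1 + lam) ^+ 2 * (1 - La) ^+ 2.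
Proof.
move=> gb eta1 lam1.
have /andP[La0 La1] : 0 <= La <= 1 by exact: apcg_rate_bounds.
have lam0 : 0 <= lam by rewrite exprn_ge0// subr_ge0.
have /andP[mg g1] := gb.
have := apcg_rate_sqrt n gb eta1; rewrite -/La -/lam.
have := apcg_rate_gamma n g; rewrite -/La.
have /andP[gn1 gn2] := iter_next_bounds n gb.
have g0 : 0 < g by exact: lt_le_trans mg.
have gn0 : 0 < iter n apcg_next g by exact: lt_le_trans gn1.
have r0 : 0 < Num.sqrt mut by rewrite sqrtr_gt0.
have rE : Num.sqrt mut ^+ 2 = mut by rewrite sqr_sqrtr// ltW.
have gE : Num.sqrt g ^+ 2 = g by rewrite sqr_sqrtr// ltW.
have gnE : Num.sqrt (iter n apcg_next g) ^+ 2 = iter n apcg_next g.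
  by rewrite sqr_sqrtr// ltW.
have rs : Num.sqrt mut <= Num.sqrt (iter n apcg_next g) by rewrite ler_wsqrtr.
have ss : Num.sqrt (iter n apcg_next g) <= Num.sqrt g by rewrite ler_wsqrtr.
rewrite -{1}gnE -[X in _ = _ * (X - _)]gE -[X in _ - X = _]rE -[X in _ = _ * (_ - X)]rE.
rewrite -[X in La * (X / _)]gE -[X in La * (_ / X)]rE.
move: (Num.sqrt mut) (Num.sqrt g) (Num.sqrt (iter n apcg_next g)) r0 rs ss.
move: La lam La0 La1 lam0 lam1; clear => La lam La0 La1 lam0 lam1.
move=> r s0 s r0 rs ss E1 E2.
have s_gt0 : 0 < s by exact: lt_le_trans rs.
have B0 : 0 < (s + r) ^+ 2 by rewrite exprn_gt0// addr_gt0.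
have key : (1 - lam) * s <= (1 + lam) * (r * (1 - La)).
  have X0 : 0 <= r * (1 - La) + s.
    by rewrite addr_ge0 ?mulr_ge0 ?subr_ge0// ltW.
  have h1 := ler_wpM2r X0 E2.
  have h2 : 0 <= 2 * r * La * (s * (s0 - s) + r * (s0 + r) * (1 - La)).
    by rewrite !mulr_ge0 ?addr_ge0 ?mulr_ge0 ?subr_ge0 ?addr_ge0// ltW// (lt_le_trans s_gt0).
  have h3 : 2 * r * La * (s * (s0 - s) + r * (s0 + r) * (1 - La)) =
     (s + r) ^+ 2 * (r * (1 - La) - s) + La * (s0 + r) ^+ 2 * (r * (1 - La) + s).
    have -> : La * (s0 + r) ^+ 2 = La * (s0 ^+ 2 - r ^+ 2) + 2 * La * r * (s0 + r).
      by ring.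
    rewrite -E1.
    have -> : 2 * r * La * (s * (s0 - s) + r * (s0 + r) * (1 - La)) =
       2 * r * La * (s * (s0 - s) + r * (s0 + r) * (1 - La)) + 0 by rewrite addr0.
    ring.
  rewrite -(ler_pM2l B0); move: h1 h2; rewrite h3.
  move: (La * (s0 + r) ^+ 2) ((s + r) ^+ 2) (r * (1 - La)) => A B C; clear.
  by move=> *; lra.
have -> : 1 - La + La * (s0 ^+ 2 / r ^+ 2) = s ^+ 2 / r ^+ 2.
  have -> : s ^+ 2 = r ^+ 2 + La * (s0 ^+ 2 - r ^+ 2) by rewrite -E1 addrC subrK.
  by field; rewrite gt_eqF.
rewrite mulrA ler_pdivrMr ?exprn_gt0// -!exprMn -mulrA [(1 - La) * r]mulrC.
have l0 : 0 <= (1 - lam) * s by rewrite mulr_ge0 ?subr_ge0// ltW.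
by rewrite ler_sqr// nnegrE (le_trans l0 key).
Qed.

End parameters.

(** * Runs of APCG and their average over the samples *)

Lemma sum_tuple_cons {R : nmodType} (T : finType) (n : nat) (F : seq T -> R) :
  \sum_(s : n.+1.-tuple T) F s = \sum_i \sum_(s : n.-tuple T) F (i :: s).
Proof.
rewrite pair_big/= (reindex (fun p : T * n.-tuple T => [tuple of p.1 :: p.2]))//=.
exists (fun s : n.+1.-tuple T => (thead s, [tuple of behead s])) => [[i s] _|s _] /=.
  by congr (_, _); apply: val_inj.
by apply: val_inj => /=; case/tupleP: s => i s.
Qed.

Section apcg_run.
Context {R : realType} {m : nat} {d : 'I_m -> nat}.
Local Notation D := (\sum_(i < m) d i)%N.
Local Notation V := 'cV[R]_D.
Variables (f : V -> R) (phi : forall i, 'cV[R]_(d i) -> \bar R).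
Arguments phi : clear implicits.
Variables (Lt : 'I_m -> R) (mut : R).
Hypothesis phi_proper : forall i, eproper (phi i).
Hypothesis phi_convex : forall i, econvex (phi i).
Hypothesis Lt_gt0 : forall i, 0 < Lt i.
Hypothesis m_gt0 : (0 < m)%N.
Hypothesis mut_gt0 : 0 < mut.
Hypothesis mut_lt1 : mut < 1.
Hypothesis f_descent : forall (x v : V) i, (forall l, l != i -> block l v = 0) ->
  f (x + v) <= f x + dotv (block i (grad f x)) (block i v)
               + Lt i / 2 * enorm (block i v) ^+ 2.
Hypothesis f_convex : forall x u : V,
  f x + dotv (grad f x) (u - x) + mut / 2 * wnorm Lt (u - x) ^+ 2 <= f u.

Local Notation dom := (sdom phi).
Local Notation Phi := (ssum phi).
Local Notation N2 x := (wnorm Lt x ^+ 2).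
Local Notation step := (apcg_step f phi Lt mut).

(** The parameters are existentially quantified step by step, so that a run
    from [z <> w] splits into its first step and a run. *)
Fixpoint apcg_run (g : R) (w z : V) (s : seq 'I_m) (wt : V) : Prop :=
  if s is i :: s' then exists al be g' y w' z',
    step g w z i al be g' y w' z' /\ apcg_run g' w' z' s' wt
  else w = wt.

Lemma apcg_apcg_run g0 t s w0 wt : apcg f phi Lt mut g0 t s w0 wt ->
  apcg_run g0 w0 w0 (mkseq s t) wt.
Proof.
move=> [al [be [g [w [y [z [g0E w0E z0E wtE H]]]]]]].
suff G n k : (k + n)%N = t -> apcg_run (g k) (w k) (z k) (map s (iota k n)) (w t).
  by have := G t 0%N (add0n t); rewrite g0E w0E z0E wtE.
elim: n k => [k|n IH k]; first by rewrite addn0 => ->.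
rewrite addnS => kt /=; have kt' : (k < t)%N by rewrite -kt ltnS leq_addr.
have [h1 h2 h3 h4 h5] := H k kt'.
exists (al k), (be k), (g k.+1), (y k), (w k.+1), (z k.+1); split.
  by split.
by apply: IH; rewrite addSn.
Qed.

Lemma apcg_step_params g w z i al be g' y w' z' : mut <= g ->
  step g w z i al be g' y w' z' ->
  [/\ al = apcg_alpha m mut g, g' = apcg_next m mut g, be = al * mut / g' &
      y = (al * g + g')^-1 *: ((al * g) *: z + g' *: w)].
Proof.
move=> mg [[/andP[al0 _] alE] [g'E beE] yE _ _].
have alE' := apcg_alpha_unique m_gt0 mut_gt0 mg al0 alE.
by split => //; rewrite /apcg_next -alE'.
Qed.

(** Two minimizers: add their growth inequalities at one another. *)
Lemma apcg_step_unique g w z i al be g' y w1 w2 z1 z2 :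
  step g w z i al be g' y w1 z1 -> step g w z i al be g' y w2 z2 ->
  w1 = w2 /\ z1 = z2.
Proof.
move=> [[/andP[al0 _] _] [g'E beE] yE zmin1 ->] [_ _ _ zmin2 ->].
suff -> : z1 = z2 by [].
pose c := (1 - be) *: z + be *: y.
have E (v : V) : v - (1 - be) *: z - be *: y = v - c by rewrite /c opprD addrA.
have Mal2 : 0 < m%:R * al / 2 by rewrite divr_gt0// mulr_gt0// ltr0n.
have P (z0 : V) : is_argmin (fun x : V =>
            (m%:R * al / 2 *
               wnorm Lt (x - (1 - be) *: z - be *: y) ^+ 2 +
             dotv (block i (grad f y)) (block i x))%:E
            + phi i (block i x))%E z0 ->
    is_argmin (fun x : V => (m%:R * al / 2 * wnorm Lt (x - c) ^+ 2
      + dotv (block i (grad f y)) (block i x))%:E + phi i (block i x))%E z0.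
  by move=> zmin x; have := zmin x; rewrite !E.
have [zF1 zl1 /(_ (block i z2)) H1] :=
  block_prox phi_proper phi_convex Mal2 Lt_gt0 (P _ zmin1).
have [zF2 zl2 /(_ (block i z1)) H2] :=
  block_prox phi_proper phi_convex Mal2 Lt_gt0 (P _ zmin2).
apply: block_ext => l; have [->|li] := eqVneq l i; last by rewrite zl1// zl2.
have := H1 zF2; have := H2 zF1; rewrite (dist_sqrC (block i z2) (block i z1)).
set k := m%:R * al / 2 * Lt i => h1 h2.
have k0 : 0 < k by rewrite mulr_gt0.
have : k * enorm (block i z1 - block i z2) ^+ 2 <= 0.
  move: h1 h2; clearbody k; clear; move=> *; lra.
rewrite pmulr_rle0// enorm_sqr => h; apply/eqP; rewrite -subr_eq0; apply/eqP.
by apply: dotvv_eq0; apply/eqP; rewrite eq_le h dotvv_ge0.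
Qed.

Lemma apcg_next_ge g : mut <= g <= 1 -> mut <= apcg_next m mut g <= 1.
Proof.
by move=> gb; have [_ /andP[-> _] -> _] := apcg_next_bounds m_gt0 mut_gt0 gb.
Qed.

Lemma apcg_run_unique g w z s w1 w2 : mut <= g <= 1 ->
  apcg_run g w z s w1 -> apcg_run g w z s w2 -> w1 = w2.
Proof.
elim: s g w z => [g w z _ /= <-//|i s IH g w z gb /=].
move=> [al [be [g' [y [w' [z' [s1 r1]]]]]]] [al2 [be2 [g2 [y2 [w'2 [z'2 [s2 r2]]]]]]].
have /andP[mg _] := gb.
have [alE g'E beE yE] := apcg_step_params mg s1.
have [alE2 g'E2 beE2 yE2] := apcg_step_params mg s2.
subst al al2; subst g' g2; subst be be2; subst y y2.
have [ww zz] := apcg_step_unique s1 s2; subst w'2 z'2.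
by apply: IH r1 r2; exact: apcg_next_ge.
Qed.

(** Averaging over the samples one iteration at a time: the remaining runs
    started from each of the [m] possible successors are again a full family,
    because the successor is determined by the sampled block. *)
Lemma apcg_run_mean n g w z Psi (out : seq 'I_m -> V) :
  mut <= g <= 1 -> apcg_state phi g w z Psi ->
  (forall s, size s = n -> apcg_run g w z s (out s)) ->
  (forall s, size s = n -> dom (out s)) /\
  forall u, dom u ->
    \sum_(s : n.-tuple 'I_m) (f (out s) + Phi (out s)) <=
    m%:R ^+ n * (apcg_rate m mut n g * (f w + Psi + g / 2 * N2 (z - u))
                 + (1 - apcg_rate m mut n g) * (f u + Phi u)).
Proof.
elim: n g w z Psi out => [|n IH] g w z Psi out gb st H.
  have out0 : out [::] = w by rewrite -(H [::]).
  have /andP[mg g1] := gb; have g0 : 0 < g by exact: lt_le_trans mg.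
  have [dw wPsi] := apcg_state_le g0 st.
  split => [s /size0nil->|u du]; first by rewrite out0.
  rewrite (eq_bigr (fun=> f w + Phi w)) => [|s _]; last by rewrite tuple0 /= out0.
  rewrite sumr_const card_tuple expn0 mulr1n expr0 mul1r /= mul1r subrr mul0r addr0.
  rewrite -addrA lerD2l (le_trans wPsi)// lerDl mulr_ge0 ?sqr_ge0//.
  by rewrite divr_ge0// ltW.
have /andP[mg g1] := gb.
pose i0 := Ordinal m_gt0.
set al := apcg_alpha m mut g; set g' := apcg_next m mut g.
pose be := al * mut / g'.
pose y := (al * g + g')^-1 *: ((al * g) *: z + g' *: w).
have /choice[wz wzP] i : exists p : V * V, step g w z i al be g' y p.1 p.2.
  have [|al2 [be2 [g2 [y2 [w'2 [z'2 [s2 r2]]]]]]] := H (i :: nseq n i).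
    by rewrite /= size_nseq.
  have [alE2 g'E2 beE2 yE2] := apcg_step_params mg s2.
  by subst al2 g2 be2 y2; exists (w'2, z'2).
have [Psi' [st' PsiP]] := apcg_step_state phi_proper phi_convex Lt_gt0 m_gt0
  mut_gt0 mut_lt1 f_descent f_convex mg st wzP.
have gb' := apcg_next_ge gb.
have R' i s : size s = n -> apcg_run g' (wz i).1 (wz i).2 s (out (i :: s)).
  move=> sn; have [|al2 [be2 [g2 [y2 [w'2 [z'2 [s2 r2]]]]]]] := H (i :: s).
    by rewrite /= sn.
  have [alE2 g'E2 beE2 yE2] := apcg_step_params mg s2.
  subst al2 g2 be2 y2.
  by have [ww zz] := apcg_step_unique s2 (wzP i); subst w'2 z'2.
have IHi i := IH g' _ _ _ (fun s => out (i :: s)) gb' (st' i) (R' i).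
split; first by move=> [//|i s] [sn]; exact: (IHi i).1.
move=> u du.
rewrite (sum_tuple_cons n (fun s => f (out s) + Phi (out s))).
apply: (le_trans (ler_sum _ (fun i _ => (IHi i).2 u du))).
rewrite -mulr_sumr exprSr -mulrA ler_pM2l ?exprn_gt0 ?ltr0n//.
rewrite big_split/= -mulr_sumr sumr_const card_ord -[_ *+ m]mulr_natl.
have /andP[r0 r1] := apcg_rate_bounds m_gt0 mut_gt0 n gb'.
have := ler_wpM2l r0 (PsiP u du).
rewrite -/g' -/al; set X := \sum_(i < m) _; set r := apcg_rate _ _ n _.
move: (m%:R : R) (f w + Psi + g / 2 * _) (f u + Phi u).
by clear; move=> *; lra.
Qed.

End apcg_run.

(** * The proximal subproblems *)

Section constants.
Context {R : realType} {m : nat}.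
Variables (L : 'I_m -> R) (mu : R).
Hypothesis m_gt0 : (0 < m)%N.
Hypothesis L_gt0 : forall i, 0 < L i.
Hypothesis mu_gt0 : 0 < mu.

Lemma Ltilde_gt0 i : 0 < Ltilde L mu i.
Proof. by rewrite addr_gt0// mulr_gt0. Qed.

Lemma Ltilde_le_max i : Ltilde L mu i <= Ltilde_max L mu.
Proof. exact: le_bigmax_cond. Qed.

Lemma Ltilde_max_gt : 2 * mu < Ltilde_max L mu.
Proof.
apply: lt_le_trans (Ltilde_le_max (Ordinal m_gt0)).
by rewrite ltrDr.
Qed.

Lemma Ltilde_max_gt0 : 0 < Ltilde_max L mu.
Proof. by apply: lt_trans Ltilde_max_gt; rewrite mulr_gt0. Qed.

Lemma kappa_ge1 : 1 <= Ltilde_max L mu / Ltilde_min L mu.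
Proof.
have min0 : 0 < Ltilde_min L mu.
  by rewrite /Ltilde_min; apply/bigmin_gtP; split => [|i _];
    [exact: Ltilde_max_gt0|exact: Ltilde_gt0].
rewrite ler_pdivlMr// mul1r.
apply: (@le_trans _ _ (Ltilde L mu (Ordinal m_gt0))); last exact: Ltilde_le_max.
exact: bigmin_le_cond.
Qed.

Lemma mutilde1_gt0 : 0 < mutilde1 L mu.
Proof. by rewrite divr_gt0// Ltilde_max_gt0. Qed.

Lemma mutilde1_lt1 : mutilde1 L mu < 1.
Proof.
rewrite ltr_pdivrMr ?Ltilde_max_gt0// mul1r (lt_trans _ Ltilde_max_gt)//.
by rewrite ltr_pMl// ltr1n.
Qed.

Lemma wnorm_le {d : 'I_m -> nat} (v : 'cV[R]_(\sum_(i < m) d i)%N) :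
  mutilde1 L mu * wnorm (Ltilde L mu) v ^+ 2 <= mu * enorm v ^+ 2.
Proof.
rewrite wnorm_sqr; last by move=> i; rewrite ltW// Ltilde_gt0.
rewrite enorm_sqr_block /mutilde1 -mulrA ler_pM2l// ler_pdivrMl ?Ltilde_max_gt0//.
rewrite mulr_sumr; apply: ler_sum => i _.
by rewrite ler_wpM2r ?sqr_ge0// Ltilde_le_max.
Qed.

End constants.

Section prox.
Context {R : realType} {m : nat} {d : 'I_m -> nat}.
Local Notation D := (\sum_(i < m) d i)%N.
Local Notation V := 'cV[R]_D.
Variables (f : V -> R) (phi : forall i, 'cV[R]_(d i) -> \bar R).
Arguments phi : clear implicits.
Variables (Li : 'I_m -> R) (mu : R).
Hypothesis m_gt0 : (0 < m)%N.
Hypothesis f_diff : forall x, differentiable f x.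
Hypothesis Li_gt0 : forall i, 0 < Li i.
Hypothesis f_smooth : block_smooth Li f.
Hypothesis mu_gt0 : 0 < mu.
Hypothesis f_wconvex : weakly_convex mu f.
Hypothesis phi_proper : forall i, eproper (phi i).
Hypothesis phi_convex : forall i, econvex (phi i).
Hypothesis phi_lsc : forall i, lower_semicontinuous (phi i).
Hypothesis F_bounded : forall r : R,
  bounded_set [set u | (objective f phi u <= r%:E)%E].

Local Notation dom := (sdom phi).
Local Notation Phi := (ssum phi).
Local Notation Lt := (Ltilde Li mu).
Local Notation mut := (mutilde1 Li mu).

Definition fprox (x : V) (u : V) : R := f u + mu * enorm (u - x) ^+ 2.

Lemma fprox_descent x y v i : (forall l, l != i -> block l v = 0) ->
  fprox x (y + v) <= fprox x y + dotv (block i (grad (fprox x) y)) (block i v)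
                   + Lt i / 2 * enorm (block i v) ^+ 2.
Proof.
move=> v0; rewrite /fprox grad_prox// blockD blockZ dotvDl dotvZl.
have := block_descent y f_diff f_smooth v0.
have -> : dotv (block i (y - x)) (block i v) = dotv (y - x) v.
  by rewrite (dotv_block1 _ v0).
have -> : y + v - x = (y - x) + v by rewrite addrAC.
rewrite enorm_sqrD.
have -> : enorm v ^+ 2 = enorm (block i v) ^+ 2.
  by rewrite !enorm_sqr (dotv_block1 _ v0).
rewrite /Ltilde; move: (enorm (block i v) ^+ 2) (dotv (y - x) v) => A B.
by lra.
Qed.

(** [mu |. - x|^2] has modulus [2 mu] and [f] loses [mu]. *)
Lemma fprox_sconvex x y u :
  fprox x y + dotv (grad (fprox x) y) (u - y) + mu / 2 * enorm (u - y) ^+ 2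
  <= fprox x u.
Proof.
rewrite /fprox grad_prox// dotvDl dotvZl.
have := f_wconvex u y.
have -> : u - x = (y - x) + (u - y) by rewrite [RHS]addrC subrKA.
rewrite (enorm_sqrD (y - x)).
move: (enorm (u - y) ^+ 2) (dotv (y - x) (u - y)) (enorm (y - x) ^+ 2) => A B C.
by lra.
Qed.

Lemma fprox_convex x y u :
  fprox x y + dotv (grad (fprox x) y) (u - y) + mut / 2 * wnorm Lt (u - y) ^+ 2
  <= fprox x u.
Proof.
apply: le_trans (fprox_sconvex x y u); rewrite lerD2l.
have := wnorm_le m_gt0 Li_gt0 mu_gt0 (u - y).
move: (wnorm _ _ ^+ 2) (enorm _ ^+ 2) => A B; lra.
Qed.

Lemma fprox_segment x u v (s : R) : 0 <= s <= 1 ->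
  fprox x (s *: u + (1 - s) *: v)
  <= s * fprox x u + (1 - s) * fprox x v - mu / 2 * s * (1 - s) * enorm (u - v) ^+ 2.
Proof.
move=> /andP[s0 s1]; set y := s *: u + (1 - s) *: v.
have hu := fprox_sconvex x y u; have hv := fprox_sconvex x y v.
have uy : u - y = (1 - s) *: (u - v).
  by apply/matrixP => j k; rewrite !mxE; ring.
have vy : v - y = (- s) *: (u - v).
  by apply/matrixP => j k; rewrite !mxE; ring.
rewrite uy dotvZr enormZ exprMn real_normK ?num_real// in hu.
rewrite vy dotvZr enormZ exprMn real_normK ?num_real// in hv.
have s1' : 0 <= 1 - s by rewrite subr_ge0.
have := ler_wpM2l s0 hu; have := ler_wpM2l s1' hv.
move: (fprox x u) (fprox x v) (fprox x y) (dotv _ _) (enorm _ ^+ 2).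
by move=> *; lra.
Qed.

Definition Fval (u : V) : R := f u + Phi u.

Lemma objectiveE u : dom u -> objective f phi u = (Fval u)%:E.
Proof. by move=> du; rewrite /objective separableE// EFinD. Qed.

Lemma objective_dom u : (objective f phi u < +oo)%E -> dom u.
Proof.
move=> Fu; apply: separable_sdom => //; move: Fu.
by rewrite /objective; case: (separable phi u) => //= r _; rewrite ltry.
Qed.

Definition Fprox (x : V) (u : V) : R := Fval u + mu * enorm (u - x) ^+ 2.

Lemma Fprox_segment x u v (s : R) : dom u -> dom v -> 0 <= s <= 1 ->
  Fprox x (s *: u + (1 - s) *: v)
  <= s * Fprox x u + (1 - s) * Fprox x v - mu / 2 * s * (1 - s) * enorm (u - v) ^+ 2.
Proof.
move=> du dv s01; rewrite /Fprox /Fval.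
have := fprox_segment x u v s01; rewrite /fprox.
have := ssum_conv phi_proper phi_convex du dv s01.
by lra.
Qed.

Definition prox_min (rho : R) (x w p : V) : Prop :=
  dom p /\ forall u, dom u ->
    Fprox x p + rho * enorm (p - w) ^+ 2 <= Fprox x u + rho * enorm (u - w) ^+ 2.

Lemma prox_min_ex (rho : R) x w : 0 <= rho -> exists p, prox_min rho x w p.
Proof.
move=> rho0.
pose h u := f u + (mu * enorm (u - x) ^+ 2 + rho * enorm (u - w) ^+ 2).
pose g u := ((h u)%:E + separable phi u)%E.
have [v0 dv0] := sdom_ex phi_proper.
have gE u : dom u -> g u = (Fprox x u + rho * enorm (u - w) ^+ 2)%:E.
  by move=> du; rewrite /g separableE// -EFinD; congr EFin; rewrite /h /Fprox /Fval; ring.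
have glsc : lower_semicontinuous g.
  apply: lsc_add => [u|u||]; first exact: ltNyr.
  - exact: separable_gtNy.
  - apply: lsc_continuous => u.
    have cf : {for u, continuous f} by exact: differentiable_continuous.
    have sq (a : R) (z : V) : {for u, continuous (fun v : V => a * enorm (v - z) ^+ 2)}.
      have ca : {for u, continuous (fun _ : V => a)} by exact: cst_continuous.
      exact: (continuousM ca (@continuous_enorm_sqr _ _ z u)).
    exact: (continuousD cf (continuousD (sq mu x) (sq rho w))).
  - apply: lsc_sum => [i u|i]; first by have [+ _] := phi_proper i; exact.
    apply: (@lsc_comp _ _ _ (block i) (phi i)) => //.
    exact: continuous_mulmx.
have [||p pmin] := @lsc_argmin _ _ g v0 glsc.
- by rewrite gE// ltry.
- move=> r; apply: sub_boundedr (F_bounded r) => A /= FA u gu.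
  apply: FA; apply: le_trans gu; rewrite /objective /g leeD2r// lee_fin /h lerDl.
  by rewrite addr_ge0// mulr_ge0 ?sqr_ge0// ltW.
have dp : dom p.
  apply: separable_sdom => //; have := pmin v0; rewrite (gE v0)//.
  by rewrite /g; case: (separable phi p) => //= r _; rewrite ltry.
exists p; split => // u du.
by have := pmin u; rewrite !gE// lee_fin.
Qed.

(** The modulus of [Fp x] plus that of the [rho] term gives growth
    [rho + mu / 2] around [p]; another [rho] comes from the value of the [rho]
    term at [p]. *)
Lemma prox_min_growth (rho : R) x w p : 0 <= rho -> prox_min rho x w p -> dom w ->
  Fprox x p + (2 * rho + mu / 2) * enorm (w - p) ^+ 2 <= Fprox x w.
Proof.
move=> rho0 [dp pmin] dw.
have H : Fprox x p + rho * enorm (p - w) ^+ 2 + (rho + mu / 2) * enorm (w - p) ^+ 2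
    <= Fprox x w.
  apply: growth_of_segment => s /andP[s0 s1].
  have s01 : 0 <= s <= 1 by rewrite !ltW.
  apply: (le_trans (pmin _ (sdom_conv phi_proper phi_convex dw dp s01))).
  have := Fprox_segment x dw dp s01.
  have -> : s *: w + (1 - s) *: p - w = (1 - s) *: (p - w).
    by apply/matrixP => j k; rewrite !mxE; ring.
  rewrite enormZ exprMn real_normK ?num_real// (dist_sqrC p w).
  move: (Fprox x w) (Fprox x p) (enorm _ ^+ 2) (Fprox x _).
  by move=> *; lra.
move: H; rewrite (dist_sqrC p w); lra.
Qed.

(** At the minimizer of [F + mu |. - x|^2 + rho |. - w|^2] the quadratic terms
    have the opposite gradient; they differ from their linearization by a
    square, which is negligible in a regular subgradient inequality. *)
Lemma prox_min_subgradient (rho : R) x w p : 0 <= rho -> prox_min rho x w p ->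
  limiting_subdifferential (objective f phi) p
    (- ((2 * mu) *: (p - x) + (2 * rho) *: (p - w))).
Proof.
move=> rho0 [dp pmin]; set v := - _.
have FE := objectiveE dp.
have Ffin : objective f phi p \is a fin_num by rewrite FE.
split => //; exists (fun=> p), (fun=> v); split.
- exact: cvg_cst.
- exact: cvg_cst.
- exact: cvg_cst.
move=> _; split => // e e0.
have H : \forall y \near p, (mu + rho) * enorm (y - p) < e.
  have cb : {for p, continuous (fun y : V => y - p)}.
    by apply: continuousB; [exact: cvg_id|exact: cst_continuous].
  have ce : {for p, continuous (fun y : V => enorm (y - p))}.
    exact: (continuous_comp cb (@continuous_enorm R D _)).
  have ca : {for p, continuous (fun _ : V => mu + rho)} by exact: cst_continuous.
  have : (mu + rho) * enorm (y - p) @[y --> p] --> (mu + rho) * enorm (p - p).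
    exact: (continuousM ca ce).
  by rewrite subrr enorm0 mulr0 => /cvgr_lt; apply.
apply: filterS H => y ye.
have [yoo|] := ltP (objective f phi y) +oo%E; last first.
  by rewrite leye_eq => /eqP ->; rewrite leey.
have dy := objective_dom yoo.
rewrite FE objectiveE// -EFinD lee_fin.
have := pmin y dy; rewrite /Fprox.
have -> : y - x = (p - x) + (y - p) by rewrite [RHS]addrC subrKA.
have -> : y - w = (p - w) + (y - p) by rewrite [RHS]addrC subrKA.
rewrite (enorm_sqrD (p - x)) (enorm_sqrD (p - w)).
rewrite /v dotvNl (dotvDl ((2 * mu) *: _)) !dotvZl.
have : (mu + rho) * enorm (y - p) ^+ 2 <= e * enorm (y - p).
  by rewrite expr2 mulrA ler_wpM2r ?enorm_ge0// ltW.
move: (enorm (y - p) ^+ 2) (enorm (y - p)) (enorm (p - x) ^+ 2) (enorm (p - w) ^+ 2).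
by move=> *; lra.
Qed.

End prox.

(** * One round of ACPP *)

Section average.
Context {R : realType}.
Implicit Types (T : finType).

Definition avg T (h : T -> R) : R := #|T|%:R^-1 * \sum_x h x.

Lemma avg_le T (h1 h2 : T -> R) : (forall x, h1 x <= h2 x) -> avg h1 <= avg h2.
Proof. by move=> H; rewrite ler_wpM2l ?invr_ge0// ler_sum. Qed.

Lemma eq_avg T (h1 h2 : T -> R) : h1 =1 h2 -> avg h1 = avg h2.
Proof. by move=> H; congr (_ * _); apply: eq_bigr. Qed.

Lemma avgD T (h1 h2 : T -> R) : avg (fun x => h1 x + h2 x) = avg h1 + avg h2.
Proof. by rewrite /avg big_split mulrDr. Qed.

Lemma avgZ T (c : R) (h : T -> R) : avg (fun x => c * h x) = c * avg h.
Proof. by rewrite /avg -mulr_sumr mulrCA. Qed.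

Lemma avg_cst T (c : R) : (0 < #|T|)%N -> avg (fun _ : T => c) = c.
Proof.
by move=> T0; rewrite /avg sumr_const -[c *+ _]mulr_natl mulKf// pnatr_eq0 -lt0n.
Qed.

Lemma avg_ge0 T (h : T -> R) : (forall x, 0 <= h x) -> 0 <= avg h.
Proof. by move=> H; rewrite mulr_ge0 ?invr_ge0// sumr_ge0. Qed.

(** Conditioning on the first sample. *)
Lemma avg_tuple_cons T n (h : seq T -> R) :
  avg (fun s : n.+1.-tuple T => h s) =
  avg (fun x : T => avg (fun s : n.-tuple T => h (x :: s))).
Proof.
rewrite /avg (sum_tuple_cons n h) !card_tuple -mulr_sumr mulrA.
by rewrite expnS natrM invfM.
Qed.

End average.

Section arithmetic.
Context {R : realType}.
Implicit Types lam mu eps Dl s d q : R.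

(** The number 25 is [16 (5 / 4)^2], from the coefficient of [w - p] in
    [residual] below. *)
Lemma tradeoff_poly lam : 0 <= lam ->
  25 * lam * (1 - 2 * lam) <= 4 * ((1 + 2 * lam) * (1 - lam) ^+ 2).
Proof.
move=> l0; rewrite -subr_ge0.
(* the tangent at [3/10], close to the minimum, of the cubic part *)
have h3 : lam ^+ 3 - (27/100) * lam + 54/1000 = (lam - 3/10) ^+ 2 * (lam + 6/10).
  by field.
have h4 : 0 <= (lam - 3/10) ^+ 2 * (lam + 6/10).
  by rewrite mulr_ge0 ?sqr_ge0//; lra.
have := sqr_ge0 (lam - 3/10).
move: h3 h4; rewrite !expr2 !exprS expr0 mulr1.
nra.
Qed.

(** What a round gains: [eps] is the mean optimality gap of its output [w] for
    the subproblem, [Dl] that of its start [x], and [s], [d], [q] are the mean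
    squared lengths of [w - x], [w - p] and of the residual, so that
    [Dl - eps + mu s] is the mean decrease of [F]. *)
Lemma round_gain lam mu eps Dl s d q : 0 < lam < 1 / 2 -> 0 < mu ->
  0 <= d -> mu * d <= eps -> (1 + lam) ^+ 2 * eps <= 4 * lam * Dl -> 0 <= s ->
  q <= 2 / (1 - 2 * lam) * s + 2 / (1 + 2 * lam) * (25 / 16 * d) ->
  (1 - 2 * lam) * (mu / 2) * d <= 2 * lam * (Dl - eps + mu * s) /\
  (1 - 2 * lam) * (mu / 2) * q <= Dl - eps + mu * s.
Proof.
move=> /andP[l0 l1] mu0 d0 de eD s0 qs.
have eps0 : 0 <= eps by rewrite (le_trans _ de)// mulr_ge0// ltW.
have l2 : 0 < 1 - 2 * lam by lra.
have l3 : 0 < 1 + 2 * lam by lra.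
have gap : (1 - lam) ^+ 2 * eps <= 4 * lam * (Dl - eps).
  have -> : (1 - lam) ^+ 2 = (1 + lam) ^+ 2 - 4 * lam by ring.
  move: eD; lra.
have ms0 : 0 <= mu * s by rewrite mulr_ge0// ltW.
split.
  have h1 : (1 - 2 * lam) * eps <= (1 - lam) ^+ 2 * eps.
    by apply: ler_wpM2r => //; have := sqr_ge0 lam; lra.
  have h2 : (1 - 2 * lam) * (mu * d) <= (1 - 2 * lam) * eps by rewrite ler_pM2l.
  have h3 : 0 <= lam * (mu * s) by rewrite mulr_ge0// ltW.
  by move: h1 h2 h3 gap; lra.
have h1 : (1 - 2 * lam) * (mu / 2) * q <=
    mu * s + (1 - 2 * lam) / (1 + 2 * lam) * (25 / 16) * (mu * d).
  have h : 0 < (1 - 2 * lam) * (mu / 2) by rewrite mulr_gt0// divr_gt0.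
  move: qs; rewrite -(ler_pM2l h) => /le_trans; apply.
  rewrite le_eqVlt; apply/orP; left; apply/eqP; field.
  by rewrite !gt_eqF.
apply: (le_trans h1); rewrite addrC lerD2r.
apply: (@le_trans _ _ ((1 - 2 * lam) / (1 + 2 * lam) * (25 / 16) * eps)).
  by rewrite ler_wpM2l// mulr_ge0// divr_ge0// ltW.
rewrite -(ler_pM2l (_ : 0 < 4 * lam * (1 + 2 * lam))); last by rewrite !mulr_gt0.
have -> : 4 * lam * (1 + 2 * lam) * ((1 - 2 * lam) / (1 + 2 * lam) * (25 / 16) * eps)
   = (25 * lam * (1 - 2 * lam)) / 4 * eps by field; rewrite gt_eqF.
have h4 : (25 * lam * (1 - 2 * lam)) / 4 * eps <= (1 + 2 * lam) * (1 - lam) ^+ 2 * eps.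
  by apply: ler_wpM2r => //; have := tradeoff_poly (ltW l0); lra.
apply: (le_trans h4); rewrite -mulrA [4 * lam * _]mulrC -[leRHS]mulrA.
by rewrite ler_pM2l.
Qed.

(** The estimate for a point at the fraction [th] of the segment from the start
    to a global minimizer: [G] is the gap of [F] at the start and [R2] the
    squared length of the segment. This [th] makes the coefficient of [G] equal
    to [2 lam], and the trade-off inequality keeps that of [R2] below [mu]. *)
Lemma start_gain lam mu La Th G R2 (th := (1 - 2 * lam) / (1 - La)) :
  0 < lam < 1 / 2 -> 0 < mu -> 0 <= La <= 1 -> La <= Th -> 0 <= R2 ->
  (1 - lam) ^+ 2 * (1 - La + Th) <= (1 + lam) ^+ 2 * (1 - La) ^+ 2 ->
  0 <= th <= 1 /\
  La * G + (1 - La) * ((1 - th) * G + th * (mu * R2)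
     - mu / 2 * th * (1 - th) * R2) + Th * (mu / 2) * (th ^+ 2 * R2)
  <= 2 * lam * G + mu * R2.
Proof.
move=> /andP[l0 l1] mu0 /andP[La0 La1] LaTh R20 trade.
have l2 : 0 < 1 - 2 * lam by lra.
have La2 : 0 < 1 - La /\ La <= 2 * lam.
  have h : (1 - lam) ^+ 2 <= ((1 + lam) * (1 - La)) ^+ 2.
    rewrite exprMn; apply: le_trans trade; rewrite ler_peMr ?sqr_ge0//; lra.
  have h' : 1 - lam <= (1 + lam) * (1 - La).
    move: h; rewrite ler_sqr ?nnegrE// ?mulr_ge0 ?subr_ge0//; lra.
  have lLa : 0 <= lam * La by rewrite mulr_ge0// ltW.
  split; last by lra.
  rewrite lt_neqAle subr_ge0 La1 andbT eq_sym; apply/eqP => La1'.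
  by move: h'; rewrite La1' mulr0; lra.
have [La1' La2'] := La2.
have thE : th * (1 - La) = 1 - 2 * lam by rewrite /th divfK// gt_eqF.
have th0 : 0 <= th by rewrite /th ltW// divr_gt0.
have th1 : th <= 1 by rewrite /th ler_pdivrMr// mul1r; lra.
split; first by rewrite th0.
clearbody th.
have key : th ^+ 2 * (1 - La + Th) <= 1.
  have h1 : (1 - lam) ^+ 2 * (th ^+ 2 * (1 - La + Th)) <= (1 + lam) ^+ 2 * (1 - 2 * lam) ^+ 2.
    have -> : (1 + lam) ^+ 2 * (1 - 2 * lam) ^+ 2 =
      th ^+ 2 * ((1 + lam) ^+ 2 * (1 - La) ^+ 2) by rewrite -thE; ring.
    by rewrite mulrCA ler_wpM2l ?sqr_ge0.
  have l3 : 0 < (1 - lam) ^+ 2 by rewrite exprn_gt0//; lra.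
  rewrite -(ler_pM2l l3) mulr1; apply: (le_trans h1).
  have h2 : (1 + lam) ^+ 2 * (1 - 2 * lam) <= 1.
    have : 0 <= lam ^+ 2 * (3 + 2 * lam) by rewrite mulr_ge0 ?sqr_ge0//; lra.
    by lra.
  rewrite [(1 - 2 * lam) ^+ 2]expr2 mulrA.
  apply: (@le_trans _ _ (1 - 2 * lam)); first by rewrite ler_piMl// ltW.
  by have := sqr_ge0 lam; lra.
have E : La * G + (1 - La) * ((1 - th) * G + th * (mu * R2)
     - mu / 2 * th * (1 - th) * R2) + Th * (mu / 2) * (th ^+ 2 * R2) =
   (1 - th * (1 - La)) * G
   + mu * R2 / 2 * (th * (1 - La) + th ^+ 2 * (1 - La + Th)) by field.
rewrite E thE.
have mR : 0 <= mu * R2 / 2 by rewrite divr_ge0// mulr_ge0// ltW.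
have : mu * R2 / 2 * (1 - 2 * lam + th ^+ 2 * (1 - La + Th)) <= mu * R2 / 2 * 2.
  by rewrite ler_wpM2l//; lra.
by lra.
Qed.

End arithmetic.

Section round.
Context {R : realType} {m : nat} {d : 'I_m -> nat}.
Local Notation D := (\sum_(i < m) d i)%N.
Local Notation V := 'cV[R]_D.
Variables (f : V -> R) (phi : forall i, 'cV[R]_(d i) -> \bar R).
Arguments phi : clear implicits.
Variables (Li : 'I_m -> R) (mu : R) (t : nat).
Hypothesis m_gt0 : (0 < m)%N.
Hypothesis f_diff : forall x, differentiable f x.
Hypothesis Li_gt0 : forall i, 0 < Li i.
Hypothesis f_smooth : block_smooth Li f.
Hypothesis mu_gt0 : 0 < mu.
Hypothesis f_wconvex : weakly_convex mu f.
Hypothesis phi_proper : forall i, eproper (phi i).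
Hypothesis phi_convex : forall i, econvex (phi i).
Hypothesis phi_lsc : forall i, lower_semicontinuous (phi i).
Hypothesis F_bounded : forall r : R,
  bounded_set [set u | (objective f phi u <= r%:E)%E].

Local Notation dom := (sdom phi).
Local Notation Phi := (ssum phi).
Local Notation Lt := (Ltilde Li mu).
Local Notation mut := (mutilde1 Li mu).
Local Notation T := (t.-tuple 'I_m).
Local Notation F := (Fval f phi).
Local Notation Fp := (Fprox f phi mu).
Local Notation eta := (Num.sqrt mut / m%:R).
Local Notation lam := ((1 - eta) ^+ t).

Definition round (g : R) (x : V) (out : T -> V) : Prop :=
  forall s : T, apcg_run (fprox f mu x) phi Lt mut g x x s (out s).

Lemma eta_bounds : 0 < eta < 1.
Proof.
have mut0 := mutilde1_gt0 m_gt0 Li_gt0 mu_gt0.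
have mut1 := mutilde1_lt1 m_gt0 Li_gt0 mu_gt0.
rewrite divr_gt0 ?sqrtr_gt0 ?ltr0n//= ltr_pdivrMr ?ltr0n// mul1r.
apply: (@lt_le_trans _ _ 1); last by rewrite ler1n.
by rewrite -[ltRHS]sqrtr1 ltr_sqrt.
Qed.

Lemma lam_bounds : 0 < lam <= 1.
Proof.
have /andP[e0 e1] := eta_bounds.
rewrite exprn_gt0 ?subr_gt0//= exprn_ile1 ?subr_ge0 ?(ltW e1)// ?gerBl ?(ltW e0).
Qed.

Lemma card_T : (0 < #|{: T}|)%N.
Proof. by rewrite card_tuple card_ord expn_gt0 m_gt0. Qed.

(** The APCG estimate in Euclidean terms: [mut |.|^2] in the weighted norm is
    at most [mu |.|^2]. *)
Lemma round_mean g x out (La := apcg_rate m mut t g) : dom x -> mut <= g <= 1 ->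
  round g x out ->
  (forall s, dom (out s)) /\ forall u, dom u ->
  avg (fun s => Fp x (out s)) <=
    La * F x + (1 - La) * Fp x u + La * (g / mut) * (mu / 2) * enorm (u - x) ^+ 2.
Proof.
move=> dx gb H.
have mut0 := mutilde1_gt0 m_gt0 Li_gt0 mu_gt0.
have mut1 := mutilde1_lt1 m_gt0 Li_gt0 mu_gt0.
have Lt0 := Ltilde_gt0 Li_gt0 mu_gt0.
have /andP[mg g1] := gb.
pose out' (s : seq 'I_m) := if insub s is Some s' then out s' else x.
have out'E (s : T) : out' s = out s by rewrite /out' valK.
have H' s : size s = t -> apcg_run (fprox f mu x) phi Lt mut g x x s (out' s).
  by move=> /eqP st; have := H (Tuple st); rewrite -out'E.
have [dout mean] := apcg_run_mean phi_proper phi_convex Lt0 m_gt0 mut0 mut1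
  (fprox_descent mu f_diff f_smooth x) (fprox_convex m_gt0 f_diff Li_gt0 mu_gt0 f_wconvex x)
  gb (apcg_state0 dx g1) H'.
split; first by move=> s; rewrite -out'E; apply: dout; exact: size_tuple.
move=> u du; have := mean u du.
rewrite (eq_bigr (fun s : T => Fp x (out s))); last first.
  by move=> s _; rewrite out'E /Fprox /fprox /Fval; ring.
rewrite /avg card_tuple card_ord natrX ler_pdivrMl ?exprn_gt0 ?ltr0n// => h.
apply: (le_trans h); rewrite ler_pM2l ?exprn_gt0 ?ltr0n// -/La.
have /andP[La0 La1] : 0 <= La <= 1 by exact: apcg_rate_bounds.
have -> : fprox f mu x x = f x by rewrite /fprox subrr enorm0 expr0n mulr0 addr0.
have -> : fprox f mu x u + Phi u = Fp x u by rewrite /fprox /Fprox /Fval; ring.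
rewrite mulrDr -!addrA lerD2l addrC lerD2l.
have W : wnorm Lt (x - u) ^+ 2 <= mut^-1 * (mu * enorm (u - x) ^+ 2).
  by rewrite ler_pdivlMl// dist_sqrC; exact: wnorm_le.
have : La * (g / 2) * wnorm Lt (x - u) ^+ 2 <=
   La * (g / 2) * (mut^-1 * (mu * enorm (u - x) ^+ 2)).
  by rewrite ler_wpM2l// mulr_ge0// divr_ge0// (le_trans _ mg)// ltW.
rewrite !mulrA => /le_trans; apply.
by rewrite le_eqVlt; apply/orP; left; apply/eqP; ring.
Qed.

Lemma rate_tradeoff g (La := apcg_rate m mut t g) : mut <= g <= 1 ->
  [/\ 0 <= La <= 1, La <= La * (g / mut) &
  (1 - lam) ^+ 2 * (1 - La + La * (g / mut)) <= (1 + lam) ^+ 2 * (1 - La) ^+ 2].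
Proof.
move=> gb; have mut0 := mutilde1_gt0 m_gt0 Li_gt0 mu_gt0.
have Lab := apcg_rate_bounds m_gt0 mut0 t gb.
have /andP[La0 La1] := Lab; split => //.
  by rewrite ler_peMr// ler_pdivlMr// mul1r; case/andP: gb.
apply: apcg_rate_tradeoff => //; first by have /andP[_ /ltW] := eta_bounds.
by have /andP[] := lam_bounds.
Qed.

(** The point near [w] at which the subdifferential of [F] is estimated. The
    weight [mu / 4] makes the growth constant of [prox_min_growth] equal to
    [mu]. *)
Definition output_point (x w : V) : V :=
  xget 0 [set p | prox_min f phi mu (mu / 4) x w p].

Lemma output_pointP x w : prox_min f phi mu (mu / 4) x w (output_point x w).
Proof.
have [|p pP] := @prox_min_ex R m d f phi mu f_diff mu_gt0 phi_proper phi_lsc F_bounded (mu / 4) x w.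
  by rewrite divr_ge0// ltW.
exact: (@xgetPex _ 0 [set p | prox_min f phi mu (mu / 4) x w p] (ex_intro _ p pP)).
Qed.

(** By [prox_min_subgradient], [- 2 mu] times the residual is a subgradient of
    [F] at the output point [p]; it also equals [(w - x) - 5 / 4 (w - p)]. *)
Definition residual (x w : V) : V :=
  (output_point x w - x) + 4^-1 *: (output_point x w - w).

(** Comparing with the point at the fraction [th = (1 - La) / (1 - La + Th)] of
    the segment from [x] to the minimizer of the subproblem, where the quadratic
    terms cancel, gives the contraction [epsDl]; the rest is [round_gain]. *)
Lemma round_progress g x out : dom x -> mut <= g <= 1 -> round g x out ->
  lam < 1 / 2 ->
  [/\ forall s, dom (out s),
  (1 - 2 * lam) * (mu / 2) * avg (fun s => enorm (out s - output_point x (out s)) ^+ 2)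
    <= 2 * lam * (F x - avg (fun s => F (out s))) &
  (1 - 2 * lam) * (mu / 2) * avg (fun s => enorm (residual x (out s)) ^+ 2)
    <= F x - avg (fun s => F (out s))].
Proof.
move=> dx gb H lam2.
have [dout mean] := round_mean dx gb H.
have [/andP[La0 La1] LaTh trade] := rate_tradeoff gb.
have /andP[l0 _] := lam_bounds.
set La := apcg_rate _ _ _ _ in La0 La1 LaTh trade mean.
set Th := La * _ in LaTh trade mean.
have [xs [dxs xsmin]] := @prox_min_ex R m d f phi mu f_diff mu_gt0 phi_proper phi_lsc F_bounded 0 x x (lexx _).
have {}xsmin u : dom u -> Fp x xs <= Fp x u.
  by move=> du; have := xsmin u du; rewrite !mul0r !addr0.
have Fxx : Fp x x = F x by rewrite /Fprox subrr enorm0 expr0n mulr0 addr0.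
pose eps := avg (fun s => Fp x (out s)) - Fp x xs.
pose Dl := F x - Fp x xs.
have Dl0 : 0 <= Dl by rewrite subr_ge0 -Fxx; exact: xsmin.
pose r2 := enorm (xs - x) ^+ 2.
have C1 := card_T.
have X0 : 0 < 1 - La + Th.
  apply: (@lt_le_trans _ _ 1) => //; lra.
have epsDl : (1 + lam) ^+ 2 * eps <= 4 * lam * Dl.
  pose th := (1 - La) / (1 - La + Th).
  have th0 : 0 <= th by rewrite divr_ge0 ?subr_ge0// ltW.
  have th1 : th <= 1 by rewrite ler_pdivrMr// mul1r lerDl (le_trans La0).
  have thE : th * (1 - La + Th) = 1 - La by rewrite /th divfK// gt_eqF.
  have th01 : 0 <= th <= 1 by rewrite th0.
  have := mean _ (sdom_conv phi_proper phi_convex dxs dx th01).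
  have seg := Fprox_segment f_diff f_wconvex phi_proper phi_convex x dxs dx th01.
  have -> : th *: xs + (1 - th) *: x - x = th *: (xs - x).
    by apply/matrixP => j k; rewrite !mxE; ring.
  rewrite enormZ exprMn real_normK ?num_real// -/r2 Fxx in seg * => meanE.
  have seg' : (1 - La) * Fp x (th *: xs + (1 - th) *: x) <= (1 - La) *
    (th * Fp x xs + (1 - th) * F x - mu / 2 * th * (1 - th) * r2).
    by rewrite ler_wpM2l// subr_ge0.
  have E1 : eps <= Dl * (1 - th * (1 - La)).
    have : mu / 2 * r2 * th * (th * (1 - La + Th) - (1 - La)) = 0.
      by rewrite thE subrr mulr0.
    move=> E0; rewrite /eps /Dl.
    move: (Fp x (th *: xs + (1 - th) *: x)) (avg (fun s => Fp x (out s)))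
      (Fp x xs) (F x) seg' E0 meanE; clear; move=> *; lra.
  have E2 : (1 - lam) ^+ 2 * Dl <= (1 + lam) ^+ 2 * (th * (1 - La)) * Dl.
    apply: ler_wpM2r => //; rewrite -(ler_pM2r X0).
    apply: (le_trans trade).
    have -> : (1 + lam) ^+ 2 * (th * (1 - La)) * (1 - La + Th) =
      (1 + lam) ^+ 2 * ((1 - La) * (th * (1 - La + Th))) by ring.
    by rewrite thE -expr2.
  have /(ler_wpM2l (sqr_ge0 (1 + lam))) := E1.
  by move: E2; lra.
pose dd (s : T) := enorm (out s - output_point x (out s)) ^+ 2.
pose ss (s : T) := enorm (out s - x) ^+ 2.
pose qq (s : T) := enorm (residual x (out s)) ^+ 2.
have deps : mu * avg dd <= eps.
  have : avg (fun s => Fp x xs + mu * dd s) <= avg (fun s => Fp x (out s)).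
    apply: avg_le => s; have P := output_pointP x (out s).
    have mu4 : 0 <= mu / 4 by rewrite divr_ge0// ltW.
    have := prox_min_growth f_diff f_wconvex phi_proper phi_convex mu4 P (dout s).
    have := xsmin _ P.1; rewrite /dd; move: (enorm _ ^+ 2) => e; lra.
  by rewrite avgD avg_cst// avgZ /eps; lra.
have FE : F x - avg (fun s => F (out s)) = Dl - eps + mu * avg ss.
  rewrite /Dl /eps (_ : avg (fun s => Fp x (out s)) = avg (fun s => F (out s)) + mu * avg ss).
    by ring.
  by rewrite -avgZ -avgD.
have l12 : 0 < lam < 1 / 2 by rewrite l0.
have qqs : avg qq <= 2 / (1 - 2 * lam) * avg ss + 2 / (1 + 2 * lam) * (25 / 16 * avg dd).
  rewrite -!avgZ -avgD; apply: avg_le => s; rewrite /qq /ss /dd /residual.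
  set p := output_point _ _; set w := out s.
  have -> : p - x + 4^-1 *: (p - w) = (w - x) + (- (5 / 4)) *: (w - p).
    by apply/matrixP => j k; rewrite !mxE; field.
  (* This weight leaves for [ss] exactly the coefficient that the term
     [mu * avg ss] of the decrease can pay for. *)
  have c0 : 0 < (1 + 2 * lam) / (1 - 2 * lam) by rewrite divr_gt0//; lra.
  have := Young_dotv (w - x) ((- (5 / 4)) *: (w - p)) c0.
  rewrite (enorm_sqrD (w - x)) enormZ exprMn real_normK ?num_real//.
  move: (2 * dotv _ _) (enorm (w - x) ^+ 2) (enorm (w - p) ^+ 2) => A B C.
  have a1 : 0 < 1 - 2 * lam by lra.
  have a2 : 0 < 1 + 2 * lam by lra.
  have -> : 2 / (1 - 2 * lam) = 1 + (1 + 2 * lam) / (1 - 2 * lam).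
    by field; rewrite gt_eqF.
  have -> : 2 / (1 + 2 * lam) * (25 / 16 * C) = (1 + ((1 + 2 * lam) / (1 - 2 * lam))^-1)
     * ((- (5 / 4)) ^+ 2 * C).
    by field; rewrite !gt_eqF.
  by lra.
have ss0 : 0 <= avg ss by apply: avg_ge0 => s; exact: sqr_ge0.
have dd0 : 0 <= avg dd by apply: avg_ge0 => s; exact: sqr_ge0.
have [g1 g2] := round_gain l12 mu_gt0 dd0 deps epsDl ss0 qqs.
by rewrite FE.
Qed.

(** The global minimizer replaces that of the subproblem as target, which
    bounds the gap of [F] itself. *)
Lemma first_round g x out xs : dom x -> dom xs -> mut <= g <= 1 -> round g x out ->
  lam < 1 / 2 ->
  (forall s, dom (out s)) /\
  avg (fun s => F (out s)) - F xs <= mu * enorm (x - xs) ^+ 2 + 2 * lam * (F x - F xs).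
Proof.
move=> dx dxs gb H lam2.
have [dout mean] := round_mean dx gb H.
have [/andP[La0 La1] LaTh trade] := rate_tradeoff gb.
have /andP[l0 _] := lam_bounds.
set La := apcg_rate _ _ _ _ in La0 La1 LaTh trade mean.
set Th := La * _ in LaTh trade mean.
have l12 : 0 < lam < 1 / 2 by rewrite l0.
have Lab : 0 <= La <= 1 by rewrite La0.
split => //.
have [th01 G] := start_gain (F x - F xs) l12 mu_gt0 Lab LaTh (sqr_ge0 (enorm (xs - x))) trade.
set th := (1 - 2 * lam) / (1 - La) in th01 G.
have := mean _ (sdom_conv phi_proper phi_convex dxs dx th01).
have seg := Fprox_segment f_diff f_wconvex phi_proper phi_convex x dxs dx th01.
have -> : th *: xs + (1 - th) *: x - x = th *: (xs - x).
  by apply/matrixP => j k; rewrite !mxE; ring.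
rewrite enormZ exprMn real_normK ?num_real// (dist_sqrC x xs).
have Fxx : Fp x x = F x by rewrite /Fprox subrr enorm0 expr0n mulr0 addr0.
rewrite Fxx in seg.
have seg' : (1 - La) * Fp x (th *: xs + (1 - th) *: x) <= (1 - La) *
    (th * Fp x xs + (1 - th) * F x - mu / 2 * th * (1 - th) * enorm (xs - x) ^+ 2).
  by rewrite ler_wpM2l// subr_ge0.
have Fle : avg (fun s => F (out s)) <= avg (fun s => Fp x (out s)).
  by apply: avg_le => s; rewrite /Fprox lerDl mulr_ge0 ?sqr_ge0// ltW.
have FxsE : Fp x xs = F xs + mu * enorm (xs - x) ^+ 2 by [].
rewrite FxsE in seg'.
move: seg' Fle G; clearbody Th La th.
move: (Fp x (th *: xs + (1 - th) *: x)) (avg (fun s => Fp x (out s)))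
  (avg (fun s => F (out s))) (F xs) (F x) (enorm (xs - x) ^+ 2).
by clear; move=> *; lra.
Qed.

End round.

(** * The telescoping sum over the rounds *)

Section process.
Context {R : realType} {V : Type} (T : finType).
Variables (dom : V -> Prop) (rd : nat -> V -> (T -> V) -> Prop).
Variables (cost : V -> V -> R) (val : V -> R) (C low : R).
Hypothesis T_gt0 : (0 < #|T|)%N.
Hypothesis C_ge0 : 0 <= C.
Hypothesis val_ge : forall x, dom x -> low <= val x.
Hypothesis rd_progress : forall k x out, dom x -> rd k x out ->
  (forall s, dom (out s)) /\
  avg (fun s => cost x (out s)) <= C * (val x - avg (fun s => val (out s))).

(** The rounds are averaged from the last to the first: for fixed earlier
    samples the progress inequality of a round is an inequality between
    averages over its own samples, and the values of [val] telescope. *)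
Lemma process_cost n k0 (Y : seq T -> V) : dom (Y [::]) ->
  (forall s, (size s < n)%N -> rd (k0 + size s)%N (Y s) (fun x => Y (rcons s x))) ->
  avg (fun s : n.-tuple T => \sum_(j < n) cost (Y (take j s)) (Y (take j.+1 s)))
    <= C * (val (Y [::]) - low).
Proof.
elim: n k0 Y => [k0 Y dY _|n IH k0 Y dY H].
  rewrite (eq_avg (h2 := fun=> 0)); last by move=> s; rewrite big_ord0.
  rewrite avg_cst; last by rewrite card_tuple expn0.
  by rewrite mulr_ge0// subr_ge0 val_ge.
have [dom1 prog] := rd_progress dY (H [::] isT).
rewrite (avg_tuple_cons _ (fun s =>
  \sum_(j < n.+1) cost (Y (take j s)) (Y (take j.+1 s)))).
apply: (@le_trans _ _ (avg (fun x => cost (Y [::]) (Y [:: x]) + C * (val (Y [:: x]) - low)))).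
  apply: avg_le => x.
  rewrite (eq_avg (h2 := fun s : n.-tuple T => cost (Y [::]) (Y [:: x]) +
     \sum_(j < n) cost (Y (x :: take j s)) (Y (x :: take j.+1 s)))); last first.
    by move=> s; rewrite big_ord_recl /= take0.
  rewrite avgD avg_cst ?lerD2l; last by rewrite card_tuple expn_gt0 T_gt0.
  apply: (IH k0.+1 (fun s => Y (x :: s))); first exact: dom1.
  move=> s sn; have := H (x :: s); rewrite /= ltnS => /(_ sn).
  by rewrite addnS addSn.
rewrite avgD avgZ avgD avg_cst//.
by move: prog; rewrite /=; lra.
Qed.

(** The first round contributes no cost; its effect is the bound [B] on the mean
    value after it. *)
Lemma process_cost_tail n (Y : seq T -> V) (B : R) :
  (forall x, dom (Y [:: x])) ->
  (forall s, (0 < size s < n.+1)%N -> rd (size s) (Y s) (fun x => Y (rcons s x))) ->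
  avg (fun x => val (Y [:: x])) - low <= B ->
  avg (fun s : n.+1.-tuple T =>
    \sum_(j < n) cost (Y (take j.+1 s)) (Y (take j.+2 s))) <= C * B.
Proof.
move=> dY H Hb.
rewrite (avg_tuple_cons _ (fun s =>
  \sum_(j < n) cost (Y (take j.+1 s)) (Y (take j.+2 s)))).
apply: (@le_trans _ _ (avg (fun x => C * (val (Y [:: x]) - low)))).
  apply: avg_le => x /=.
  apply: (@process_cost n 1%N (fun s => Y (x :: s))) => //.
  by move=> s sn; have := H (x :: s); rewrite /= ltnS => /(_ sn).
rewrite avgZ avgD avg_cst// ler_wpM2l//.
Qed.

End process.

(** * Uniformly distributed random variables with finitely many values *)

Lemma finite_set_finType (Z : finType) (A : set Z) : finite_set A.
Proof.
by apply: (@sub_finite_set _ A [set: Z]).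
Qed.

Section finite_rv.
Context {R : realType} {dO : measure_display} {Om : measurableType dO}.
Variables (P : probability Om R) (Z : finType) (xi : Om -> Z).
Hypothesis xi_fiber : forall z, measurable (xi @^-1` [set z]).

Lemma measurable_fun_finite {d' : measure_display} {T' : measurableType d'}
  (g : Z -> T') : measurable_fun [set: Om] (g \o xi).
Proof.
move=> _ A mA; rewrite setTI.
have -> : (g \o xi) @^-1` A = \bigcup_(z in g @^-1` A) xi @^-1` [set z].
  apply/seteqP; split => [w /= Aw|w [z /= Az ->]//].
  by exists (xi w).
by apply: fin_bigcup_measurable => //; exact: finite_set_finType.
Qed.

Hypothesis xi_uniform : forall z, P (xi @^-1` [set z]) = (#|Z|%:R^-1)%:E.

Lemma integral_finite (h : Z -> R) : (forall z, 0 <= h z) ->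
  (\int[P]_w (h (xi w))%:E = (avg h)%:E)%E.
Proof.
move=> h0.
have E w : (h (xi w))%:E = (\sum_(z : Z) (h z)%:E * (\1_(xi @^-1` [set z]) w)%:E)%E.
  rewrite (bigD1 (xi w))//= big1 ?adde0 => [|z zw].
    by rewrite indicE mem_set//= mule1.
  rewrite indicE memNset ?mule0//= => /esym/eqP; exact/negP.
under eq_integral do rewrite E.
rewrite ge0_integral_sum//=.
- rewrite /avg mulr_sumr -sumEFin; apply: eq_bigr => z _.
  rewrite ge0_integralZl_EFin//.
  + rewrite integral_indic// setIT.
    by rewrite [X in (_ * X)%E](xi_uniform z) -EFinM mulrC.
  + apply/measurable_EFinP; exact: measurable_indic.
- move=> z; apply/measurable_EFinP; apply: measurable_funM => //; exact: measurable_indic.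
- by move=> z w _; rewrite mule_ge0// lee_fin.
Qed.

Lemma fiber_inhabited z : exists w, xi w = z.
Proof.
apply: contrapT => nw; have := xi_uniform z.
have -> : xi @^-1` [set z] = set0.
  by apply/seteqP; split => // w /= wz; apply: nw; exists w.
by rewrite measure0 => /eqP; rewrite eqe eq_sym invr_eq0 pnatr_eq0 => /eqP/card0_eq/(_ z).
Qed.

End finite_rv.

Section sampling_law.
Context {R : realType} {dO : measure_display} {Om : measurableType dO}.
Variables (P : probability Om R) (m K t : nat).
Variables (I : nat -> nat -> Om -> 'I_m) (khat : Om -> nat).
Hypothesis K_gt0 : (0 < K)%N.
Hypothesis sampling : acpp_sampling P K t I khat.

Definition samples (w : Om) : K.+1.-tuple (t.-tuple 'I_m) :=
  [tuple [tuple I k j w | j < t] | k < K.+1].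

Definition round_index (w : Om) : 'I_K := Ordinal (ltn_pmod (khat w - 2) K_gt0).

(** The whole randomness of the algorithm as one variable with values in a
    finite type. The output index is shifted so that round [j.+1] leads from
    iterate [j.+1] to iterate [j.+2]. *)
Definition outcome (w : Om) : K.+1.-tuple (t.-tuple 'I_m) * 'I_K :=
  (samples w, round_index w).

Lemma round_indexE w : round_index w = (khat w - 2)%N :> nat.
Proof.
have [_ _ /(_ w) /andP[h1 h2] _ _] := sampling.
rewrite /= modn_small// -subSn// leq_subLR.
by rewrite add2n ltnS.
Qed.

Definition outcome_code (z : K.+1.-tuple (t.-tuple 'I_m) * 'I_K)
    (a : option ('I_K.+1 * 'I_t)) : nat :=
  if a is Some kj then tnth (tnth z.1 kj.1) kj.2 else (z.2 + 2)%N.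

Lemma outcome_fiber z : outcome @^-1` [set z] =
  [set w | forall a, a \in [set: option ('I_K.+1 * 'I_t)]%SET ->
     acpp_rv I khat a w = outcome_code z a].
Proof.
have [_ _ khb _ _] := sampling.
apply/seteqP; split => [w /= <-{z} [[k j]|] _ /=|w /= H].
- by rewrite !tnth_mktuple.
- by have /= -> := round_indexE w; rewrite subnK//; case/andP: (khb w).
rewrite [z]surjective_pairing /outcome; congr (_, _).
  apply: eq_from_tnth => k; apply: eq_from_tnth => j; rewrite !tnth_mktuple.
  by apply: val_inj; have := H (Some (k, j)); rewrite finset.in_setT => /(_ isT).
apply: val_inj; have /= -> := round_indexE w.
by have := H None; rewrite finset.in_setT => /(_ isT) /= ->; rewrite addnK.
Qed.

Lemma outcome_measurable z : measurable (outcome @^-1` [set z]).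
Proof.
have [mrv _ _ _ _] := sampling.
rewrite outcome_fiber.
have -> : [set w | forall a, a \in [set: option ('I_K.+1 * 'I_t)]%SET ->
     acpp_rv I khat a w = outcome_code z a] =
   \bigcap_(a in [set: option ('I_K.+1 * 'I_t)]) (acpp_rv I khat a @^-1` [set outcome_code z a]).
  apply/seteqP; split => w /= H a _; first by apply: H; rewrite finset.in_setT.
  exact: H.
apply: fin_bigcap_measurable => [|a _]; first exact: finite_set_finType.
by rewrite -[X in measurable X]setTI; apply: mrv.
Qed.

Lemma outcome_uniform z : P (outcome @^-1` [set z]) =
  ((#|{: K.+1.-tuple (t.-tuple 'I_m) * 'I_K}|)%:R^-1)%:E.
Proof.
have [_ unifI _ unifk indep] := sampling.
rewrite outcome_fiber indep; congr EFin.
rewrite (eq_bigl xpredT) => [|a]; last by rewrite finset.in_setT.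
rewrite (bigD1 None)//= unifk; last by rewrite addn2 !ltnS /= ltn_ord.
rewrite (eq_bigr (fun=> m%:R^-1)) => [|[[k j]|]//= _]; last first.
  rewrite (_ : [set w | _] = [set w | I k j w = tnth (tnth z.1 k) j]).
    by rewrite unifI// -ltnS.
  by apply/seteqP; split => w /=; [exact: val_inj|move->].
rewrite prodr_const /=.
have -> : #|[pred i : option ('I_K.+1 * 'I_t) | i != None]| = (K.+1 * t)%N.
  by rewrite cardC1 card_option card_prod !card_ord.
rewrite card_prod !card_tuple !card_ord natrM -expnM natrX invfM mulrC exprVn.
by rewrite mulnC.
Qed.

End sampling_law.

(** * The iterates of ACPP *)

Section acpp_process.
Context {R : realType} {m : nat} {d : 'I_m -> nat}.
Local Notation D := (\sum_(i < m) d i)%N.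
Local Notation V := 'cV[R]_D.
Variables (f : V -> R) (phi : forall i, 'cV[R]_(d i) -> \bar R).
Arguments phi : clear implicits.
Variables (Li : 'I_m -> R) (mu : R) (x0 xs : V) (K t : nat) (gamma0 : nat -> R).
Context {dO : measure_display} {Om : measurableType dO}.
Variables (P : probability Om R) (I : nat -> nat -> Om -> 'I_m).
Variables (khat : Om -> nat) (x : nat -> Om -> V).
Hypothesis m_gt0 : (0 < m)%N.
Hypothesis f_diff : forall x, differentiable f x.
Hypothesis Li_gt0 : forall i, 0 < Li i.
Hypothesis f_smooth : block_smooth Li f.
Hypothesis mu_gt0 : 0 < mu.
Hypothesis f_wconvex : weakly_convex mu f.
Hypothesis phi_proper : forall i, eproper (phi i).
Hypothesis phi_convex : forall i, econvex (phi i).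
Hypothesis phi_lsc : forall i, lower_semicontinuous (phi i).
Hypothesis F_bounded : forall r : R,
  bounded_set [set u | (objective f phi u <= r%:E)%E].
Hypothesis K_gt0 : (0 < K)%N.
Hypothesis gamma0_bounds : forall k, mutilde1 Li mu <= gamma0 k <= 1.
Hypothesis sampling : acpp_sampling P K t I khat.
Hypothesis x_acpp : forall w, acpp f phi Li mu gamma0 K t (fun k j => I k j w) x0
  (fun k => x k w).

Local Notation dom := (sdom phi).
Local Notation F := (Fval f phi).
Local Notation mut := (mutilde1 Li mu).
Local Notation T := (t.-tuple 'I_m).
Local Notation lam := ((1 - Num.sqrt mut / m%:R) ^+ t).

Lemma acpp_run w k : (k <= K)%N ->
  apcg_run (fprox f mu (x k w)) phi (Ltilde Li mu) mut (gamma0 k) (x k w) (x k w)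
    (mkseq (fun j => I k j w) t) (x k.+1 w).
Proof. by move=> kK; apply: apcg_apcg_run; exact: (x_acpp w).2. Qed.

(** By uniqueness of each round. *)
Lemma acpp_determined w w' k : (k <= K.+1)%N ->
  (forall k' j, (k' < k)%N -> (j < t)%N -> I k' j w = I k' j w') ->
  x k w = x k w'.
Proof.
have mut0 := mutilde1_gt0 m_gt0 Li_gt0 mu_gt0.
have Lt0 := Ltilde_gt0 Li_gt0 mu_gt0.
elim: k => [_ _|k IH kK H]; first by rewrite (x_acpp w).1 (x_acpp w').1.
have xk : x k w = x k w'.
  by apply: IH => [|k' j k'k jt]; [exact: ltnW|apply: H => //; exact: ltnW].
have r1 := acpp_run w kK; have r2 := acpp_run w' kK.
have E : mkseq (fun j => I k j w) t = mkseq (fun j => I k j w') t.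
  by apply/eq_in_map => j; rewrite mem_iota /= => jt; exact: H.
rewrite xk E in r1.
exact: (apcg_run_unique phi_proper phi_convex Lt0 m_gt0 mut0 (gamma0_bounds k) r1 r2).
Qed.

Let i0 : 'I_m := Ordinal m_gt0.
Let tau0 : T := nseq_tuple t i0.

Lemma sample_path_ex (s : seq T) : exists w, forall k j, (k <= K)%N -> (j < t)%N ->
  I k j w = nth i0 (nth tau0 s k) j.
Proof.
pose z : K.+1.-tuple T * 'I_K := ([tuple nth tau0 s k | k < K.+1], Ordinal K_gt0).
have [w wz] := fiber_inhabited (outcome_uniform K_gt0 sampling) z.
exists w => k j kK jt.
have := congr1 (fun z => tnth (tnth z.1 (Ordinal (kK : (k < K.+1)%N))) (Ordinal jt)) wz.
by rewrite /= !tnth_mktuple (tnth_nth i0).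
Qed.

(** Every finite sequence of samples occurs, so the iterates can be read as
    functions of the samples alone. *)
Definition sample_path (s : seq T) : Om := sval (cid (sample_path_ex s)).

Lemma sample_pathE s k j : (k <= K)%N -> (j < t)%N ->
  I k j (sample_path s) = nth i0 (nth tau0 s k) j.
Proof. exact: (svalP (cid (sample_path_ex s))). Qed.

Definition iterate (s : seq T) : V := x (size s) (sample_path s).

Lemma iterateE w k : (k <= K.+1)%N -> x k w = iterate (take k (samples K t I w)).
Proof.
move=> kK; rewrite /iterate size_takel ?size_tuple//.
apply: acpp_determined => // k' j k'k jt.
have k'K : (k' < K.+1)%N by exact: leq_trans kK.
rewrite sample_pathE// nth_take//.
rewrite -(tnth_nth tau0 _ (Ordinal k'K)) tnth_mktuple.
by rewrite -(tnth_nth i0 _ (Ordinal jt)) tnth_mktuple.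
Qed.

Lemma iterate_nil : iterate [::] = x0.
Proof. exact: (x_acpp _).1. Qed.

Lemma iterate_round s : (size s <= K)%N ->
  round f phi Li mu (gamma0 (size s)) (iterate s) (fun tau => iterate (rcons s tau)).
Proof.
move=> sK tau; rewrite /iterate size_rcons.
set w := sample_path (rcons s tau).
have -> : x (size s) (sample_path s) = x (size s) w.
  apply: acpp_determined; first exact: leqW.
  move=> k' j k's jt; have k'K : (k' <= K)%N by exact: leq_trans (ltnW k's) sK.
  by rewrite !sample_pathE// nth_rcons k's.
have := acpp_run w sK; congr (apcg_run _ _ _ _ _ _ _ _ _).
apply: (@eq_from_nth _ i0); first by rewrite size_mkseq size_tuple.
move=> j; rewrite size_mkseq => jt.
by rewrite nth_mkseq// sample_pathE// nth_rcons ltnn eqxx.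
Qed.

Hypothesis dom_x0 : dom x0.
Hypothesis dom_xs : dom xs.
Hypothesis xs_min : forall u, dom u -> F xs <= F u.
Hypothesis lam_lt : lam < 1 / 2.

Local Notation B := (mu * enorm (x0 - xs) ^+ 2 + 2 * lam * (F x0 - F xs)).
Local Notation Z := (K.+1.-tuple T * 'I_K)%type.

(** For uniform [khat], the mean cost of the round leading to the output is
    [1 / K] times the total cost of the rounds after the first. *)
Lemma acpp_cost (cost : V -> V -> R) (C : R) : 0 <= C ->
  (forall g u out, dom u -> mut <= g <= 1 -> round f phi Li mu g u out ->
     avg (fun s : T => cost u (out s)) <= C * (F u - avg (fun s => F (out s)))) ->
  avg (fun z : Z => cost (iterate (take z.2.+1 z.1)) (iterate (take z.2.+2 z.1)))
  <= K%:R^-1 * (C * B).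
Proof.
move=> C0 H.
have r0 : round f phi Li mu (gamma0 0) x0 (fun tau => iterate [:: tau]).
  by rewrite -[x0 in round _ _ _ _ _ x0]iterate_nil; exact: (iterate_round (s := [::])).
have [dom1 first] := first_round m_gt0 f_diff Li_gt0 f_smooth mu_gt0 f_wconvex
  phi_proper phi_convex dom_x0 dom_xs (gamma0_bounds 0) r0 lam_lt.
have prog k u out : dom u -> round f phi Li mu (gamma0 k) u out ->
    (forall s, dom (out s)) /\
    avg (fun s : T => cost u (out s)) <= C * (F u - avg (fun s => F (out s))).
  move=> du r; split; last exact: H (gamma0_bounds k) r.
  by have [] := round_mean m_gt0 f_diff Li_gt0 f_smooth mu_gt0 f_wconvex phi_proper
    phi_convex du (gamma0_bounds k) r.
have rounds (s : seq T) : (0 < size s < K.+1)%N ->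
    round f phi Li mu (gamma0 (size s)) (iterate s) (fun tau => iterate (rcons s tau)).
  by case/andP=> _; rewrite ltnS => sK; exact: iterate_round.
have tail := @process_cost_tail R V {: T} dom
  (fun k u out => round f phi Li mu (gamma0 k) u out) cost F C (F xs)
  (card_T t m_gt0) C0 xs_min prog K iterate B dom1 rounds first.
have K0 : 0 <= (K%:R^-1 : R) by rewrite invr_ge0.
apply: le_trans (ler_wpM2l K0 tail).
rewrite /avg card_prod natrM invfM card_ord mulrAC [leRHS]mulrA mulrC.
have -> : \sum_(z : Z) cost (iterate (take z.2.+1 z.1)) (iterate (take z.2.+2 z.1)) =
   \sum_(s : K.+1.-tuple T) \sum_(j < K) cost (iterate (take j.+1 s)) (iterate (take j.+2 s)).
  by rewrite pair_bigA.
by rewrite mulrA.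
Qed.

Definition stationary_point (w : Om) : V :=
  output_point f phi mu (x (khat w).-1 w) (x (khat w) w).

Lemma khat_iterates w (z := outcome t I khat K_gt0 w) :
  x (khat w).-1 w = iterate (take z.2.+1 z.1) /\
  x (khat w) w = iterate (take z.2.+2 z.1).
Proof.
have [_ _ /(_ w)/andP[k1 k2] _ _] := sampling.
have zE : z.2 = (khat w - 2)%N :> nat by exact: round_indexE K_gt0 sampling w.
have z2 : z.2.+2 = khat w by rewrite zE -addn2 subnK.
have z1 : z.2.+1 = (khat w).-1 by rewrite -z2.
by rewrite z2 z1; split; rewrite iterateE// (leq_trans (leq_pred _)).
Qed.

Local Notation subdist := (fun w => dist 0
  (limiting_subdifferential (objective f phi) (stationary_point w))).

Lemma dist_stationary_point w : (0 <= subdist w <=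
  (2 * mu * enorm (residual f phi mu (x (khat w).-1 w) (x (khat w) w)))%:E)%E.
Proof.
apply/andP; split.
  by apply: le_ereal_inf_tmp => _ [a _ <-]; rewrite lee_fin enorm_ge0.
apply: ge_ereal_inf; set p := stationary_point w.
have Pp := output_pointP f_diff mu_gt0 phi_proper phi_lsc F_bounded
  (x (khat w).-1 w) (x (khat w) w).
have mu4 : 0 <= mu / 4 by rewrite divr_ge0// ltW.
have := prox_min_subgradient phi_proper mu4 Pp.
set v := - _ => vsub; exists (enorm (v - 0))%:E; first by exists v.
have -> : v - 0 = (- (2 * mu)) *: residual f phi mu (x (khat w).-1 w) (x (khat w) w).
  by apply/matrixP => j k; rewrite !mxE; field.
by rewrite enormZ normrN gtr0_norm// mulr_gt0.
Qed.

Let zx (z : Z) := iterate (take z.2.+1 z.1).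
Let zw (z : Z) := iterate (take z.2.+2 z.1).

Lemma stationary_pointE : stationary_point =
  (fun z => output_point f phi mu (zx z) (zw z)) \o outcome t I khat K_gt0.
Proof.
apply/funext => w; rewrite /stationary_point /=.
by have [-> ->] := khat_iterates w.
Qed.

Lemma stationary_point_random : random_point stationary_point /\
  measurable_fun [set: Om] subdist.
Proof.
have mxi := outcome_measurable K_gt0 sampling.
split=> [j|].
  rewrite stationary_pointE.
  exact: (measurable_fun_finite mxi (fun z => output_point f phi mu (zx z) (zw z) j 0)).
rewrite stationary_pointE.
exact: (measurable_fun_finite mxi (fun z => dist 0 (limiting_subdifferential
  (objective f phi) (output_point f phi mu (zx z) (zw z))))).
Qed.

Lemma khat_distance :
  ('E_P[fun w => (enorm (x (khat w) w - stationary_point w) ^+ 2)%R] <=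
   (4 * lam / (K%:R * mu * (1 - 2 * lam)) * B)%:E)%E.
Proof.
have l2 : 0 < 1 - 2 * lam by rewrite subr_gt0 mulrC -ltr_pdivlMr.
have /andP[l0 _] := lam_bounds t m_gt0 Li_gt0 mu_gt0.
rewrite unlock.
have -> : (fun w => (enorm (x (khat w) w - stationary_point w) ^+ 2)%:E) =
   (fun w => ((fun z => enorm (zw z - output_point f phi mu (zx z) (zw z)) ^+ 2)
      (outcome t I khat K_gt0 w))%:E).
  apply/funext => w; rewrite /stationary_point /=.
  by have [-> ->] := khat_iterates w.
have -> := integral_finite (outcome_measurable K_gt0 sampling)
  (outcome_uniform K_gt0 sampling)
  (fun z => sqr_ge0 (enorm (zw z - output_point f phi mu (zx z) (zw z)))).
rewrite lee_fin.
have C0 : 0 <= 4 * lam / (mu * (1 - 2 * lam)).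
  by rewrite divr_ge0 ?mulr_ge0// ltW.
have := @acpp_cost (fun u v => enorm (v - output_point f phi mu u v) ^+ 2) _ C0.
move=> /(_ _)/le_trans; apply.
  move=> g u out du gb r.
  have [_ + _] := round_progress m_gt0 f_diff Li_gt0 f_smooth mu_gt0 f_wconvex
    phi_proper phi_convex phi_lsc F_bounded du gb r lam_lt.
  have c0 : 0 < (1 - 2 * lam) * (mu / 2) by rewrite mulr_gt0// divr_gt0.
  rewrite -ler_pdivlMl// => /le_trans; apply.
  by rewrite le_eqVlt; apply/orP; left; apply/eqP; field; rewrite !gt_eqF.
by rewrite le_eqVlt; apply/orP; left; apply/eqP; field; rewrite !gt_eqF ?ltr0n.
Qed.

Lemma khat_subdist :
  (\int[P]_w (subdist w ^+ 2) <= (8 * mu / (K%:R * (1 - 2 * lam)) * B)%:E)%E.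
Proof.
have l2 : 0 < 1 - 2 * lam by rewrite subr_gt0 mulrC -ltr_pdivlMr.
have /andP[l0 _] := lam_bounds t m_gt0 Li_gt0 mu_gt0.
pose h (z : Z) := (2 * mu) ^+ 2 * enorm (residual f phi mu (zx z) (zw z)) ^+ 2.
have mh : measurable_fun [set: Om] (fun w => (h (outcome t I khat K_gt0 w))%:E).
  exact: (measurable_fun_finite (outcome_measurable K_gt0 sampling) (fun z => (h z)%:E)).
apply: (@le_trans _ _ (\int[P]_w (h (outcome t I khat K_gt0 w))%:E)%E).
  apply: ge0_le_integral => //.
  - by move=> w _; apply: sqre_ge0.
  - rewrite stationary_pointE.
    exact: (measurable_fun_finite (outcome_measurable K_gt0 sampling)
      (fun z => (dist 0 (limiting_subdifferential (objective f phi)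
        (output_point f phi mu (zx z) (zw z))) ^+ 2)%E)).
  - move=> w _; have /andP[s0 s1] := dist_stationary_point w.
    have [E1 E2] := khat_iterates w; rewrite E1 E2 in s1.
    rewrite /h -exprMn expe2 EFinM; exact: lee_pmul.
have h0 z : 0 <= h z by rewrite mulr_ge0 ?sqr_ge0.
have -> := integral_finite (outcome_measurable K_gt0 sampling)
  (outcome_uniform K_gt0 sampling) h0.
rewrite lee_fin /h avgZ.
have C0 : 0 <= 2 / (mu * (1 - 2 * lam)) by rewrite divr_ge0// mulr_ge0// ltW.
have := @acpp_cost (fun u v => enorm (residual f phi mu u v) ^+ 2) _ C0.
move=> H; apply: (@le_trans _ _ ((2 * mu) ^+ 2 * (K%:R^-1 * (2 / (mu * (1 - 2 * lam)) * B)))).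
  rewrite ler_wpM2l ?sqr_ge0//; apply: H => g u out du gb r.
  have [_ _ +] := round_progress m_gt0 f_diff Li_gt0 f_smooth mu_gt0 f_wconvex
    phi_proper phi_convex phi_lsc F_bounded du gb r lam_lt.
  have c0 : 0 < (1 - 2 * lam) * (mu / 2) by rewrite mulr_gt0// divr_gt0.
  rewrite -ler_pdivlMl// => /le_trans; apply.
  by rewrite le_eqVlt; apply/orP; left; apply/eqP; field; rewrite !gt_eqF.
by rewrite le_eqVlt; apply/orP; left; apply/eqP; field; rewrite !gt_eqF ?ltr0n.
Qed.

End acpp_process.

(** * Final bounds *)

Section final_bounds.
Context {R : realType}.

(** [1 - eta <= exp (- eta)], so after [- ln l / eta] steps of rate [1 - eta]
    at most the fraction [l] is left. *)
Lemma rate_ceil (eta l : R) (t : nat) : 0 < eta <= 1 -> 0 < l ->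
  Posz t = Num.ceil (- (eta^-1 * ln l)) -> (1 - eta) ^+ t <= l.
Proof.
move=> /andP[eta0 eta1] l0 tE.
have tl : - ln l <= t%:R * eta.
  have := ceil_ge (- (eta^-1 * ln l)); rewrite -tE -pmulrn.
  by rewrite -mulrN ler_pdivrMl// mulrC.
apply: (@le_trans _ _ (expR (- eta) ^+ t)).
  by rewrite lerXn2r ?nnegrE ?subr_ge0 ?expR_ge0//; exact: expR_ge1Dx.
rewrite -expRM_natl -[leRHS]lnK ?posrE// ler_expR mulrN lerNl.
exact: tl.
Qed.

Lemma le_scaled_bound (a : \bar R) (c c' A l l' G : R) :
  0 <= c <= c' -> 0 <= A -> 0 <= l <= l' -> 0 <= G ->
  (a <= (c * (A + l * G))%:E)%E -> (a <= c'%:E * (A%:E + l'%:E * G%:E))%E.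
Proof.
move=> /andP[c0 cc] A0 /andP[l0 ll] G0 /le_trans; apply.
have -> : (c'%:E * (A%:E + l'%:E * G%:E) = (c' * (A + l' * G))%:E)%E by [].
rewrite lee_fin ler_pM ?addr_ge0 ?mulr_ge0//.
by rewrite lerD2l ler_wpM2r.
Qed.

Lemma scaled_bound_pinfty (c A l r : R) : 0 < c -> 0 < l ->
  (c%:E * (A%:E + l%:E * (+oo - r%:E)) = +oo)%E.
Proof.
move=> c0 l0; rewrite /= gt0_muley ?lte_fin// addey//.
by rewrite gt0_muley ?lte_fin.
Qed.

Lemma distance_coef (ka la mu L K : R) : 1 <= ka -> 0 < la -> 0 < mu -> 0 < L ->
  0 < K -> la < 1 / 2 ->
  0 <= 4 * la / (K * mu * (1 - 2 * la)) <= 4 * ka * la / (K * mu * (1 - 2 * la)) /\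
  (la <= 1 / 4 -> la <= mu ^+ 2 / L ^+ 2 ->
   4 * la / (K * mu * (1 - 2 * la)) <= 8 * ka * mu / (K * L ^+ 2)).
Proof.
move=> ka1 la0 mu0 L0 K0 la2.
have ka0 : 0 < ka by exact: lt_le_trans ka1.
have g0 : 0 < 1 - 2 * la by lra.
have den0 : 0 < K * mu * (1 - 2 * la) by rewrite !mulr_gt0.
split.
  apply/andP; split; first by rewrite divr_ge0 ?(ltW den0)// mulr_ge0// ltW.
  by rewrite ler_pM2r ?invr_gt0// ler_pM2r// ler_peMr.
move=> la4 laL.
have L20 : 0 < L ^+ 2 by rewrite exprn_gt0.
have laL' : la * L ^+ 2 <= mu ^+ 2 by rewrite -ler_pdivlMr.
rewrite ler_pdivrMr// mulrAC ler_pdivlMr ?mulr_gt0//.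
have -> : 4 * la * (K * L ^+ 2) = 4 * K * (la * L ^+ 2) by ring.
apply: (@le_trans _ _ (4 * K * mu ^+ 2)); first by rewrite ler_pM2l// mulr_gt0.
have -> : 8 * ka * mu * (K * mu * (1 - 2 * la)) =
  4 * K * mu ^+ 2 * (ka * (2 * (1 - 2 * la))) by ring.
rewrite ler_peMr ?mulr_ge0 ?(ltW K0) ?(ltW mu0)//.
by rewrite mulr_ege1//; lra.
Qed.

Lemma subgradient_coef (ka la mu K : R) : 1 <= ka -> 0 < la -> 0 < mu ->
  0 < K -> la < 1 / 2 ->
  0 <= 8 * mu / (K * (1 - 2 * la)) <= 8 * ka * mu / (K * (1 - 2 * la)) /\
  (la <= 1 / 4 -> 8 * mu / (K * (1 - 2 * la)) <= 16 * ka * mu / K).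
Proof.
move=> ka1 la0 mu0 K0 la2.
have ka0 : 0 < ka by exact: lt_le_trans ka1.
have g0 : 0 < 1 - 2 * la by lra.
have den0 : 0 < K * (1 - 2 * la) by rewrite mulr_gt0.
split.
  apply/andP; split; first by rewrite divr_ge0 ?(ltW den0)// mulr_ge0// ltW.
  by rewrite ler_pM2r ?invr_gt0// ler_pM2r// ler_peMr.
move=> la4; rewrite ler_pdivrMr//.
have -> : 16 * ka * mu / K * (K * (1 - 2 * la)) = 8 * mu * (ka * (2 * (1 - 2 * la))).
  by field; rewrite gt_eqF.
rewrite ler_peMr ?mulr_ge0 ?(ltW mu0)//.
by rewrite mulr_ege1//; lra.
Qed.

End final_bounds.

Theorem theorem11 (R : realType) (m : nat) (d : 'I_m -> nat)
  (f : 'cV[R]_(\sum_(i < m) d i)%N -> R)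
  (phi : forall i : 'I_m, 'cV[R]_(d i) -> \bar R)
  (Li : 'I_m -> R) (L mu : R)
  (xstar x0 : 'cV[R]_(\sum_(i < m) d i)%N)
  (K t : nat) (gamma0 : nat -> R)
  (dO : measure_display) (Omega : measurableType dO) (P : probability Omega R)
  (I : nat -> nat -> Omega -> 'I_m) (khat : Omega -> nat)
  (x : nat -> Omega -> 'cV[R]_(\sum_(i < m) d i)%N) :
  let F := objective f phi in
  let kappa : R := Ltilde_max Li mu / Ltilde_min Li mu in
  let eta : R := Num.sqrt (mutilde1 Li mu) / m%:R in
  let lambda : R := (1 - eta) ^+ t in
  let lambdat : R := Num.min (1 / 4) (Num.min (mu ^+ 2 / L ^+ 2) (mu / (2 * L))) in
  (0 < m)%N -> (forall i, (0 < d i)%N) ->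
  C1 f -> (forall i, 0 < Li i) -> block_smooth Li f ->
  0 < L -> (forall u v, enorm (grad f u - grad f v) <= L * enorm (u - v)) ->
  0 < mu -> weakly_convex mu f ->
  (forall i, [/\ eproper (phi i), econvex (phi i) &
                 lower_semicontinuous (phi i)]) ->
  (forall r : R, bounded_set [set u | (F u <= r%:E)%E]) ->
  is_argmin F xstar -> (-oo < F xstar)%E ->
  (1 <= K)%N ->
  (forall k, mutilde1 Li mu <= gamma0 k <= 1) ->
  acpp_sampling P K t I khat ->
  (forall w, acpp f phi Li mu gamma0 K t (fun k j => I k j w) x0
               (fun k => x k w)) ->
  lambda < 1 / 2 ->
  exists xhatstar : Omega -> 'cV[R]_(\sum_(i < m) d i)%N,
    let subdist : Omega -> \bar R := fun w =>
      dist 0 (limiting_subdifferential F (xhatstar w)) in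
    [/\ random_point xhatstar /\ measurable_fun [set: Omega] subdist,
        ('E_P[fun w => (enorm (x (khat w) w - xhatstar w) ^+ 2)%R] <=
          (4 * kappa * lambda / (K%:R * mu * (1 - 2 * lambda)))%:E *
          ((mu * enorm (x0 - xstar) ^+ 2)%:E
           + (2 * lambda)%:E * (F x0 - F xstar)))%E,
        (\int[P]_w (subdist w ^+ 2) <=
          (8 * kappa * mu / (K%:R * (1 - 2 * lambda)))%:E *
          ((mu * enorm (x0 - xstar) ^+ 2)%:E
           + (2 * lambda)%:E * (F x0 - F xstar)))%E &
        Posz t = Num.ceil (- (eta^-1 * ln lambdat)) ->
        ('E_P[fun w => (enorm (x (khat w) w - xhatstar w) ^+ 2)%R] <=
          (8 * kappa * mu / (K%:R * L ^+ 2))%:E *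
          ((mu * enorm (x0 - xstar) ^+ 2)%:E
           + (mu / L)%:E * (F x0 - F xstar)))%E /\
        (\int[P]_w (subdist w ^+ 2) <=
          (16 * kappa * mu / K%:R)%:E *
          ((mu * enorm (x0 - xstar) ^+ 2)%:E
           + (mu / L)%:E * (F x0 - F xstar)))%E].
Proof.
move=> F kappa eta lambda lambdat m_gt0 _ [f_diff _] Li_gt0 f_smooth L_gt0 _ mu_gt0
  f_wconvex phiP F_bounded xs_argmin xs_Ny K_gt0 gamma0_bounds sampling x_acpp lam_lt.
have phi_proper i : eproper (phi i) by have [] := phiP i.
have phi_convex i : econvex (phi i) by have [] := phiP i.
have phi_lsc i : lower_semicontinuous (phi i) by have [] := phiP i.
have [u0 dom_u0] := sdom_ex phi_proper.
have dom_xs : sdom phi xstar.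
  apply: (objective_dom (f := f)) => //; apply: (le_lt_trans (xs_argmin u0)).
  by rewrite /F (objectiveE f dom_u0) ltry.
have xs_min u : sdom phi u -> Fval f phi xstar <= Fval f phi u.
  move=> du; rewrite -lee_fin -(objectiveE f dom_xs) -(objectiveE f du).
  exact: xs_argmin.
have FxsE : F xstar = (Fval f phi xstar)%:E by exact: objectiveE.
have /andP[lam_gt0 _] : 0 < lambda <= 1 := lam_bounds t m_gt0 Li_gt0 mu_gt0.
have kappa1 : 1 <= kappa := kappa_ge1 m_gt0 Li_gt0 mu_gt0.
have kappa0 : 0 < kappa by exact: lt_le_trans kappa1.
have K0 : 0 < K%:R :> R by rewrite ltr0n.
have gap0 : 0 < 1 - 2 * lambda by rewrite subr_gt0 mulrC -ltr_pdivlMr.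
have [c1 c1'] := distance_coef kappa1 lam_gt0 mu_gt0 L_gt0 K0 lam_lt.
have [c2 c2'] := subgradient_coef kappa1 lam_gt0 mu_gt0 K0 lam_lt.
have muL0 : 0 < mu / L by rewrite divr_gt0.
have A0 : 0 <= mu * enorm (x0 - xstar) ^+ 2 by rewrite mulr_ge0 ?sqr_ge0// ltW.
have [Fx0|] := ltP (F x0) +oo%E; last first.
  (* With an infinite right-hand side any point will do. *)
  clearbody kappa lambda.
  rewrite leye_eq => /eqP Fx0; exists (fun=> xstar) => subdist.
  rewrite Fx0 FxsE !scaled_bound_pinfty ?leey//.
    by split=> //; split=> [j|]; exact: measurable_cst.
  1-6: by rewrite ?divr_gt0 ?mulr_gt0 ?exprn_gt0.
have dom_x0 : sdom phi x0 by exact: objective_dom Fx0.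
have G0 : 0 <= Fval f phi x0 - Fval f phi xstar by rewrite subr_ge0 xs_min.
have -> : (F x0 - F xstar = (Fval f phi x0 - Fval f phi xstar)%:E)%E.
  by rewrite FxsE /F (objectiveE f dom_x0) EFinB.
have dist_le := khat_distance m_gt0 f_diff Li_gt0 f_smooth mu_gt0 f_wconvex phi_proper
  phi_convex phi_lsc F_bounded K_gt0 gamma0_bounds sampling x_acpp dom_x0 dom_xs xs_min lam_lt.
have sub_le := khat_subdist m_gt0 f_diff Li_gt0 f_smooth mu_gt0 f_wconvex phi_proper
  phi_convex phi_lsc F_bounded K_gt0 gamma0_bounds sampling x_acpp dom_x0 dom_xs xs_min lam_lt.
have l0 : 0 <= 2 * lambda by rewrite mulr_ge0// ltW.
exists (stationary_point f phi mu khat x); split.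
- exact: stationary_point_random m_gt0 Li_gt0 mu_gt0 phi_proper phi_convex K_gt0
    gamma0_bounds sampling x_acpp.
- by apply: le_scaled_bound dist_le => //; rewrite lexx andbT.
- by apply: le_scaled_bound sub_le => //; rewrite lexx andbT.
move=> tE.
have lat : lambda <= lambdat.
  apply: rate_ceil tE; last by rewrite !lt_min !divr_gt0 ?exprn_gt0 ?mulr_gt0.
  have /andP[e0 e1] := eta_bounds m_gt0 Li_gt0 mu_gt0.
  by rewrite /eta e0 ltW.
move: lat; rewrite !le_min => /and3P[la4 laL laL2].
have ll : 0 <= 2 * lambda <= mu / L.
  rewrite l0 /=; move: laL2; rewrite ler_pdivlMr ?mulr_gt0// ler_pdivlMr//.
  by rewrite mulrCA mulrA.
have /andP[c10 _] := c1; have /andP[c20 _] := c2.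
split.
- by apply: le_scaled_bound dist_le => //; rewrite c10 c1'.
- by apply: le_scaled_bound sub_le => //; rewrite c20 c2'.
Qed.
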